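(* Suppose $f\in W^{1,1}(0,T)$, $\alpha_0=1$ and $\alpha'(0)\ne0$. If $f(0)=0$, then the variable-exponent Abel integral equation $$(k*u)(t)=f(t),\quad t\in[0,T],$$ admits a unique solution $u\in L^1(0,T)$, and $$\|u\|_{L^1(0,T)}\le Q\|f\|_{W^{1,1}(0,T)}.$$ If further $|f'|\le L_f$ for $t\in[0,T]$ for some constant $L_f>0$, then $$|u(t)|\le QL_f,\quad t\in[0,T].$$ Here $Q>0$ denotes constants independent of $f$, $u$, $L_f$ and $t$.
   Context: $T>0$. The variable exponent $\alpha:[0,T]\to\mathbb R$ is three times differentiable with $|\alpha'(t)|+|\alpha''(t)|+|\alpha'''(t)|\le L$ on $[0,T]$ for some $L>0$, with $\alpha_0:=\alpha(0)$ and $0<\alpha(t)<1$ for $t\in(0,T]$. The kernel is $k(t):=\frac{t^{-\alpha(t)}}{\Gamma(1-\alpha(t))}$ for $t\in(0,T]$ and $(k*u)(t)=\int_0^tk(t-s)u(s)\,ds$. Functions in $L^1(0,T)$ are identified up to null sets. *)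

(* Defs.v *)
From HB Require Import structures.
From mathcomp Require Import all_boot all_order all_algebra.
From mathcomp Require Import all_classical all_reals all_analysis.

Set Implicit Arguments.
Unset Strict Implicit.
Unset Printing Implicit Defensive.

Import Order.TTheory GRing.Theory Num.Theory.
Import numFieldNormedType.Exports.

Local Open Scope classical_set_scope.
Local Open Scope ring_scope.

(* [b] is the derivative of [a] on the closed interval [0, T]: two-sided at
   interior points, one-sided at 0 and at T. *)
Definition deriv_on {R : realType} (T : R) (a b : R -> R) : Prop :=
  forall t, t \in `[0, T] ->
    (fun h => h^-1 * (a (t + h) - a t))
      @ within [set h | t + h \in `[0, T]] 0^' --> b t.

(* Euler's integral; meaningful for 0 < x. *)
Definition Gamma {R : realType} (x : R) : R :=
  \int[@lebesgue_measure R]_(s in `]0, +oo[) (s `^ (x - 1) * expR (- s)).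

(* Meaningful for 0 < t only; the value at 0 is never used. *)
Definition abel_kernel {R : realType} (a : R -> R) (t : R) : R :=
  t `^ (- a t) / Gamma (1 - a t).

(* The integral is the extended-real one: when it is finite, the integrand is
   necessarily integrable, so no default value is involved in [abel_eq]. *)
Definition abel_conv {R : realType} (k u : R -> R) (t : R) : \bar R :=
  (\int[@lebesgue_measure R]_(s in `]0%R, t[) (k (t - s) * u s)%:E)%E.

Definition abel_eq {R : realType} (T : R) (a f u : R -> R) : Prop :=
  forall t, t \in `[0, T] -> abel_conv (abel_kernel a) u t = (f t)%:E.

Definition L1 {R : realType} (T : R) (u : R -> R) : Prop :=
  (@lebesgue_measure R).-integrable `]0, T[ (EFin \o u).

Definition L1norm {R : realType} (T : R) (u : R -> R) : \bar R :=
  (\int[@lebesgue_measure R]_(s in `]0%R, T[) `|u s|%:E)%E.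

Definition ae_on {R : realType} (T : R) (P : R -> Prop) : Prop :=
  {ae @lebesgue_measure R, forall t, t \in `]0, T[ -> P t}.

Definition test_function {R : realType} (T : R) (phi : R -> R) : Prop :=
  [/\ forall n x, derivable (phi^`(n))%classic x 1,
      compact (closure [set x | phi x != 0]) &
      closure [set x | phi x != 0] `<=` `]0, T[].

Definition weak_derivative {R : realType} (T : R) (f g : R -> R) : Prop :=
  forall phi, test_function T phi ->
    \int[@lebesgue_measure R]_(s in `]0, T[) (f s * (phi^`())%classic s) =
    - \int[@lebesgue_measure R]_(s in `]0, T[) (g s * phi s).

(* [f] is an element of W^{1,1}(0, T) with weak derivative [g]. As an element
   of this space has a unique representative continuous on [0, T], [f] is taken
   to be that representative, which gives a meaning to its point values. *)
Definition W11 {R : realType} (T : R) (f g : R -> R) : Prop :=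
  [/\ L1 T f, L1 T g, weak_derivative T f g & {within `[0, T], continuous f}].

Definition W11norm {R : realType} (T : R) (f g : R -> R) : \bar R :=
  (L1norm T f + L1norm T g)%E.

(* Main.v *)
Require Import Defs.
From HB Require Import structures.
From mathcomp Require Import all_boot all_order all_algebra.
From mathcomp Require Import all_classical all_reals all_analysis.
From mathcomp Require Import measurable_realfun ring lra.

Import Order.TTheory GRing.Theory Num.Theory.
Import numFieldNormedType.Exports.

Local Open Scope classical_set_scope.
Local Open Scope ring_scope.

Set Implicit Arguments.
Unset Strict Implicit.
Unset Printing Implicit Defensive.

(** Put [b = 1 - a]. By the functional equation of Gamma, the kernel is
      [k t = expR (b t * ln t) * (b t / t) / Gamma (1 + b t)].
    As [b] vanishes at 0 and is differentiable there, the first factor tends to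
    1 and the second one to [- a1 0]: contrary to the classical Abel kernel,
    [k] has a limit [kappa] at 0, namely [- a1 0 / Gamma 1]. It is positive since
    [b > 0] and [a1 0 != 0]. The bounds on the first two derivatives of [a] show
    that [k'] is at most of logarithmic size at 0, so that [k] is [kappa] plus
    the primitive of an integrable function [h] ([abel_kernel_regular]).

    By Fubini, the convolution of [k] with [u] is then the primitive of
    [kappa * u] plus the convolution of [h] with [u]. On the other side, [f] is
    the primitive of its weak derivative [f'], because [f 0 = 0]
    ([W11_integral]). By Lebesgue differentiation, the Abel equation for [u] is
    therefore equivalent to the Volterra equation of the second kind
      [kappa * u + volterra h u = f'] almost everywhere
    ([abel_eq_volterra]).

    Multiplying the unknown by [expR (- c * t)] multiplies [h] by the same
    weight, and for [c] large the weighted kernel has integral at most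
    [kappa / 2] ([small_exponential_weight]). By the Schur test, convolution
    with it, divided by [kappa], has norm at most 1/2 both on integrable and on
    bounded functions. The Neumann series converges in both norms, which gives
    the solution and the two estimates with [Q = 2 * expR (c * T) / kappa]
    ([volterra_resolvent]), and the contraction gives uniqueness
    ([volterra_unique]). *)

(** * Lebesgue integrals: translations and improper primitives *)

Section Translation.
Context {R : realType}.
Local Notation mu := (@lebesgue_measure R).
Local Open Scope ereal_scope.

(** Lebesgue measure is the only measure giving intervals their lengths, and the
    image of Lebesgue measure by a translation does so. *)
Lemma lebesgue_measure_shift (c : R) (A : set R) : measurable A ->
  pushforward mu ((fun x => x - c)%R : _ -> measurableTypeR R) A = mu A.
Proof.
move=> mA; apply/esym/lebesgue_measure_unique => //=.
  exact: measurable_funB.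
move=> mphi _ [[a b]] _ <-.
rewrite /pushforward.
have -> : (fun x => x - c)%R @^-1` `]a, b] = `](a + c)%R, (b + c)%R]%classic.
  by apply/seteqP; split => x /=; rewrite !in_itv/= ltrBrDr lerBlDr.
by rewrite !lebesgue_measure_itv/= !lte_fin ltrD2r; congr (if _ then _ else _);
  rewrite -!EFinB; congr EFin; ring.
Qed.

Lemma lebesgue_measure_reflect (c : R) (A : set R) : measurable A ->
  pushforward mu ((fun x => c - x)%R : _ -> measurableTypeR R) A = mu A.
Proof.
move=> mA; apply/esym/lebesgue_measure_unique => //=.
  exact: measurable_funB.
move=> mphi _ [[a b]] _ <-.
rewrite /pushforward.
have -> : (fun x => c - x)%R @^-1` `]a, b] = `[(c - b)%R, (c - a)%R[%classic.
  by apply/seteqP; split => x /=; rewrite !in_itv/= => /andP[? ?]; apply/andP;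
   split; lra.
by rewrite !lebesgue_measure_itv/= !lte_fin ltrD2l ltrN2; congr (if _ then _ else _);
  rewrite -!EFinB; congr EFin; ring.
Qed.

(** Both integrals are differences of the integrals of the positive and negative
    parts, each of which is invariant. *)
Lemma integral_measure_preserving (phi : R -> R) (f : R -> \bar R) :
  measurable_fun setT phi ->
  (forall A : set R, measurable A ->
     pushforward mu (phi : _ -> measurableTypeR R) A = mu A) ->
  measurable_fun setT f -> \int[mu]_x f (phi x) = \int[mu]_x f x.
Proof.
move=> mphi phimu mf.
have ge0E (g : R -> \bar R) : measurable_fun setT g -> (forall x, 0 <= g x) ->
    \int[mu]_x g (phi x) = \int[mu]_x g x.
  move=> mg g0.
  have := @ge0_integral_pushforward _ _ (measurableTypeR R) (measurableTypeR R) R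
    phi mphi mu setT g measurableT mg (fun y _ => g0 y).
  rewrite preimage_setT => <-.
  by apply: eq_measure_integral => A mA _; exact: phimu.
rewrite [LHS]integralE [RHS]integralE; congr (_ - _).
- rewrite -(ge0E (f^\+) (measurable_funepos mf) (funepos_ge0 f)).
  by apply: eq_integral => x _; rewrite -[RHS]/((f^\+ \o phi) x) -funepos_comp.
- rewrite -(ge0E (f^\-) (measurable_funeneg mf) (funeneg_ge0 f)).
  by apply: eq_integral => x _; rewrite -[RHS]/((f^\- \o phi) x) -funeneg_comp.
Qed.

Lemma integral_shift (f : R -> \bar R) (c : R) : measurable_fun setT f ->
  \int[mu]_x f (x - c)%R = \int[mu]_x f x.
Proof.
apply: (@integral_measure_preserving (fun x => x - c)%R).
- exact: measurable_funB.
- exact: lebesgue_measure_shift.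
Qed.

Lemma integral_reflect (f : R -> \bar R) (c : R) : measurable_fun setT f ->
  \int[mu]_x f (c - x)%R = \int[mu]_x f x.
Proof.
apply: (@integral_measure_preserving (fun x => c - x)%R).
- exact: measurable_funB.
- exact: lebesgue_measure_reflect.
Qed.

End Translation.

(** An improper fundamental theorem of calculus, for an interval exhausted by
    segments. The limit of the boundary terms is the only information on [F] at
    the ends. The nonnegative case also shows that [f] is integrable. *)
Section ImproperFTC.
Context {R : realType} (I : set R) (f F : R -> R) (a_ b_ : nat -> R) (l : R).
Local Notation mu := (@lebesgue_measure R).
Hypothesis ab : forall n, a_ n < b_ n.
Hypothesis na : nonincreasing_seq a_.
Hypothesis nb : nondecreasing_seq b_.
Hypothesis cover : I = \bigcup_n `[a_ n, b_ n]%classic.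
Hypothesis dF : forall x, I x -> is_derive x 1 F (f x).
Hypothesis cf : forall x, I x -> {for x, continuous f}.
Hypothesis lF : F (b_ n) - F (a_ n) @[n --> \oo] --> l.

Let nd : nondecreasing_seq (fun n => `[a_ n, b_ n]%classic).
Proof.
move=> m n mn; apply/subsetPset => x /=; rewrite !in_itv/= => /andP[ax xb].
by rewrite (le_trans (na mn) ax) (le_trans xb (nb mn)).
Qed.

Let sub n : `[a_ n, b_ n] `<=` I.
Proof. by rewrite cover => x abx; exists n. Qed.

Let mI : measurable I.
Proof. by rewrite cover; exact: bigcupT_measurable. Qed.

Let FTC n : (\int[mu]_(x in `[a_ n, b_ n]) (f x)%:E = (F (b_ n) - F (a_ n))%:E)%E.
Proof.
have cF x : I x -> {for x, continuous F}.
  move=> /dF dFx; apply/differentiable_continuous/derivable1_diffP.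
  exact: ex_derive.
have Ia : I (a_ n) by apply: (@sub n); rewrite /= in_itv/= lexx ltW.
have Ib : I (b_ n) by apply: (@sub n); rewrite /= in_itv/= lexx ltW.
rewrite (@continuous_FTC2 _ f F)//.
- apply: continuous_in_subspaceT => x; rewrite inE => xab.
  by apply: cf; exact: (@sub n).
- split.
  + move=> x xab; have := @dF x (@sub n _ (subset_itv_oo_cc xab)).
    by move=> ?; exact: ex_derive.
  + by apply: cvg_at_right_filter; exact: cF.
  + by apply: cvg_at_left_filter; exact: cF.
- move=> x xab; have := @dF x (@sub n _ (subset_itv_oo_cc xab)).
  by move=> ?; rewrite derive1E derive_val.
Qed.

Let mfn n : measurable_fun `[a_ n, b_ n] f.
Proof.
apply: subspace_continuous_measurable_fun => //.
apply: continuous_in_subspaceT => x; rewrite inE => xab.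
by apply: cf; exact: (@sub n).
Qed.

Let cvg_FTC : (\int[mu]_(x in `[a_ n, b_ n]) (f x)%:E)%E @[n --> \oo] --> l%:E.
Proof. by under eq_fun do rewrite FTC; apply: cvg_EFin => //; exact: nearW. Qed.

Lemma ge0_improper_FTC : (forall x, I x -> 0 <= f x) ->
  (\int[mu]_(x in I) (f x)%:E = l%:E)%E.
Proof.
move=> f0; rewrite cover.
have c : (\int[mu]_(x in `[a_ n, b_ n]) (f x)%:E)%E @[n --> \oo] -->
    (\int[mu]_(x in \bigcup_n `[a_ n, b_ n]%classic) (f x)%:E)%E.
  apply: (@ge0_nondecreasing_set_cvg_integral _ (measurableTypeR R)) => //.
  - by move=> n; apply/measurable_EFinP; exact: mfn.
  - by move=> i x xab; rewrite lee_fin f0//; exact: (@sub i).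
exact: (cvg_unique _ c cvg_FTC).
Qed.

Lemma improper_FTC : mu.-integrable I (EFin \o f) ->
  (\int[mu]_(x in I) (f x)%:E = l%:E)%E.
Proof.
move=> fi.
have cp : (\int[mu]_(x in `[a_ n, b_ n]) (EFin \o f)^\+ x)%E @[n --> \oo] -->
    (\int[mu]_(x in \bigcup_n `[a_ n, b_ n]%classic) (EFin \o f)^\+ x)%E.
  apply: (@ge0_nondecreasing_set_cvg_integral _ (measurableTypeR R)) => //.
  by move=> n; apply/measurable_funepos/measurable_EFinP; exact: mfn.
have cn : (\int[mu]_(x in `[a_ n, b_ n]) (EFin \o f)^\- x)%E @[n --> \oo] -->
    (\int[mu]_(x in \bigcup_n `[a_ n, b_ n]%classic) (EFin \o f)^\- x)%E.
  apply: (@ge0_nondecreasing_set_cvg_integral _ (measurableTypeR R)) => //.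
  by move=> n; apply/measurable_funeneg/measurable_EFinP; exact: mfn.
rewrite -cover in cp cn.
have c : (\int[mu]_(x in `[a_ n, b_ n]) (f x)%:E)%E @[n --> \oo] -->
    (\int[mu]_(x in I) (f x)%:E)%E.
  rewrite [X in _ --> X]integralE.
  rewrite (_ : (fun n => _) = (fun n => (\int[mu]_(x in `[a_ n, b_ n]) (EFin \o f)^\+ x -
      \int[mu]_(x in `[a_ n, b_ n]) (EFin \o f)^\- x)%E)); last first.
    by apply/funext => n; exact: integralE.
  apply: cvgeB => //.
  rewrite fin_num_adde_defl// ?fin_numN.
  exact: integrable_neg_fin_num.
exact: (cvg_unique _ c cvg_FTC).
Qed.

End ImproperFTC.

Section ImproperFTC_cases.
Context {R : realType}.
Local Notation mu := (@lebesgue_measure R).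
Implicit Types f F : R -> R.

Lemma bigcup_itv_oc (b : R) : 0 < b ->
  `]0, b]%classic = \bigcup_n `[b / n.+2%:R, b]%classic.
Proof.
move=> b0; apply/seteqP; split=> x /=.
  rewrite in_itv/= => /andP[x0 xb].
  exists (Num.truncn (b / x)) => //=; rewrite in_itv/= xb andbT.
  rewrite ler_pdivrMr// mulrC -ler_pdivrMr//.
  apply: (le_trans (ltW (truncnS_gt _))).
  by rewrite ler_nat.
by move=> [n _] /=; rewrite !in_itv/= => /andP[bx ->]; rewrite andbT
  (lt_le_trans _ bx)// divr_gt0.
Qed.

Lemma nonincreasing_divn (b : R) : 0 < b ->
  nonincreasing_seq (fun n => b / n.+2%:R).
Proof.
move=> b0 m n mn; rewrite ler_pM2l// lef_pV2 ?posrE ?ltr0n// ler_nat.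
by rewrite !ltnS.
Qed.

Lemma cvg_at_right0_divn (b : R) : 0 < b -> b / n.+2%:R @[n --> \oo] --> 0^'+.
Proof.
move=> b0.
have h : b / n.+2%:R @[n --> \oo] --> (0 : R).
  rewrite -(mulr0 b); apply: cvgM; first exact: cvg_cst.
  have := @cvg_harmonic R; rewrite -(cvg_shiftS (@harmonic R)).
  exact.
move=> A A0; have [N _ hN] := h _ A0.
by exists N => // n Nn; apply: (hN n Nn); exact: divr_gt0.
Qed.

Let div_lt (b : R) n : 0 < b -> b / n.+2%:R < b.
Proof.
by move=> b0; rewrite ltr_pdivrMr// ltr_pMr// ltr1n.
Qed.

Lemma ge0_FTC_oc f F (b l0 : R) : 0 < b ->
  (forall x : R, 0 < x <= b -> is_derive x 1 F (f x)) ->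
  (forall x : R, 0 < x <= b -> {for x, continuous f}) ->
  F x @[x --> 0^'+] --> l0 ->
  (forall x : R, 0 < x <= b -> 0 <= f x) ->
  (\int[mu]_(x in `]0%R, b]) (f x)%:E = (F b - l0)%:E)%E.
Proof.
move=> b0 dF cf F0 f0.
apply: (@ge0_improper_FTC R _ f F (fun n => b / n.+2%:R) (fun=> b)) => //.
- by move=> n; exact: div_lt.
- exact: nonincreasing_divn.
- exact: bigcup_itv_oc.
- by apply: cvgB; [exact: cvg_cst|exact: (cvg_comp _ _ (cvg_at_right0_divn b0) F0)].
Qed.

Lemma FTC_oc f F (b l0 : R) : 0 < b ->
  (forall x : R, 0 < x <= b -> is_derive x 1 F (f x)) ->
  (forall x : R, 0 < x <= b -> {for x, continuous f}) ->
  F x @[x --> 0^'+] --> l0 ->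
  mu.-integrable `]0, b] (EFin \o f) ->
  (\int[mu]_(x in `]0%R, b]) (f x)%:E = (F b - l0)%:E)%E.
Proof.
move=> b0 dF cf F0 fi.
apply: (@improper_FTC R _ f F (fun n => b / n.+2%:R) (fun=> b)) => //.
- by move=> n; exact: div_lt.
- exact: nonincreasing_divn.
- exact: bigcup_itv_oc.
- by apply: cvgB; [exact: cvg_cst|exact: (cvg_comp _ _ (cvg_at_right0_divn b0) F0)].
Qed.

Lemma FTC_oy f F (l0 loo : R) :
  (forall x : R, 0 < x -> is_derive x 1 F (f x)) ->
  (forall x : R, 0 < x -> {for x, continuous f}) ->
  F x @[x --> 0^'+] --> l0 -> F x @[x --> +oo] --> loo ->
  mu.-integrable `]0, +oo[ (EFin \o f) ->
  (\int[mu]_(x in `]0%R, +oo[) (f x)%:E = (loo - l0)%:E)%E.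
Proof.
move=> dF cf F0 Foo fi.
apply: (@improper_FTC R _ f F (fun n => 1 / n.+2%:R) (fun n => n.+2%:R)) => //.
- by move=> n; apply: (lt_trans (div_lt n ltr01)); rewrite ltr1n.
- exact: nonincreasing_divn.
- by move=> m n mn; rewrite ler_nat !ltnS.
- apply/seteqP; split=> x /=.
    rewrite in_itv/= andbT => x0.
    have y0 : 0 < x^-1 by rewrite invr_gt0.
    exists (maxn (Num.truncn x) (Num.truncn x^-1)) => //=; rewrite in_itv/=; apply/andP; split.
      rewrite ler_pdivrMr// mulrC -ler_pdivrMr// div1r.
      apply: (le_trans (ltW (truncnS_gt _))).
      by rewrite ler_nat ltnS; exact: leq_trans (leq_maxr _ _) (leqnSn _).
    apply: (le_trans (ltW (truncnS_gt _))).
    by rewrite ler_nat ltnS; exact: leq_trans (leq_maxl _ _) (leqnSn _).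
  by move=> [n _] /=; rewrite !in_itv/= andbT => /andP[bx _];
    rewrite (lt_le_trans _ bx)// divr_gt0.
- by move=> x; rewrite /= in_itv/= andbT; exact: dF.
- by move=> x; rewrite /= in_itv/= andbT; exact: cf.
- apply: cvgB.
    apply: cvg_comp Foo.
    apply/cvgryPge => A; exists (Num.truncn A) => // n /= An.
    apply: (le_trans (ltW (truncnS_gt _))); rewrite ler_nat ltnS.
    exact: leq_trans An (leqnSn _).
  exact: (cvg_comp _ _ (cvg_at_right0_divn ltr01) F0).
Qed.

End ImproperFTC_cases.

(** * Small integral kernels and their Neumann series *)

(** The Schur test: bounds on the integrals of [`|K|] in each variable make the
    operator with kernel [K] a contraction both for the integral norm and for
    the essential supremum. *)
Section Schur.
Context d (X : measurableType d) (R : realType).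
Context (m : {sigma_finite_measure set X -> \bar R}) (K : X * X -> R).
Hypothesis mK : measurable_fun setT K.
Hypothesis K1 : forall s, (\int[m]_t `|K (t, s)|%:E <= (2^-1)%:E)%E.
Hypothesis K2 : forall t, (\int[m]_s `|K (t, s)|%:E <= (2^-1)%:E)%E.

Local Open Scope ereal_scope.

(** The positive operator with kernel [`|K|]: it dominates the operator with
    kernel [K] and sends nonnegative functions to nonnegative functions, so that
    all manipulations of series below reduce to monotone convergence. *)
Let A (G : X -> \bar R) t := \int[m]_s (`|K (t, s)|%:E * G s).

Let mKG (G : X -> \bar R) : measurable_fun setT G ->
  measurable_fun setT (fun z : X * X => `|K z|%:E * G z.2).
Proof.
move=> mG; apply: emeasurable_funM.
  by apply/measurable_EFinP; exact: measurableT_comp.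
by apply: measurableT_comp => //; exact: measurable_snd.
Qed.

Let mKGt (G : X -> \bar R) t : measurable_fun setT G ->
  measurable_fun setT (fun s => `|K (t, s)|%:E * G s).
Proof.
move=> mG; apply: (measurableT_comp (mKG mG)).
exact: measurable_pair1.
Qed.

Let A_ge0 G t : (forall s, 0 <= G s) -> 0 <= A G t.
Proof. by move=> G0; apply: integral_ge0 => s _; rewrite mule_ge0. Qed.

Let mA G : measurable_fun setT G -> (forall s, 0 <= G s) ->
  measurable_fun setT (A G).
Proof.
move=> mG G0.
apply: (measurable_fun_fubini_tonelli_F (m2 := m) (fun z => `|K z|%:E * G z.2)).
- exact: mKG.
- by move=> z; rewrite mule_ge0.
Qed.

(* K1 says that this operator has norm at most 1/2 on integrable functions. *)
Let intA G : measurable_fun setT G -> (forall s, 0 <= G s) ->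
  \int[m]_t A G t <= (2^-1)%:E * \int[m]_s G s.
Proof.
move=> mG G0; rewrite /A.
rewrite (fubini_tonelli (m1 := m) (m2 := m) (fun z => `|K z|%:E * G z.2)) /=;
  [|exact: mKG|by move=> z; rewrite mule_ge0].
rewrite -ge0_integralZl//.
apply: ge0_le_integral => //.
- by move=> s _; apply: integral_ge0 => t _; rewrite mule_ge0.
- apply: (measurable_fun_fubini_tonelli_G (m1 := m)
    (fun z => `|K z|%:E * G z.2)); first exact: mKG.
  by move=> z; rewrite mule_ge0.
- exact: measurable_funeM.
- move=> s _.
  under eq_integral do rewrite muleC.
  rewrite ge0_integralZl//.
  + by rewrite muleC; apply: lee_wpmul2r.
  + apply/measurable_EFinP; apply: measurableT_comp => //.
    by apply: (measurableT_comp mK); exact: measurable_pair2.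
Qed.

Let leA G H t : measurable_fun setT G -> (forall s, 0 <= G s) ->
  measurable_fun setT H -> {ae m, forall s, G s <= H s} -> (forall s, 0 <= H s) ->
  A G t <= A H t.
Proof.
move=> mG G0 mH GH H0; apply: ae_ge0_le_integral => //.
- by move=> s _; rewrite mule_ge0.
- exact: mKGt.
- by move=> s _; rewrite mule_ge0.
- exact: mKGt.
- by apply: filterS GH => s GHs _; apply: lee_wpmul2l.
Qed.

(* K2 says that this operator has norm at most 1/2 on bounded functions. *)
Let Acst (M : R) t : (0 <= M)%R -> A (cst M%:E) t <= (2^-1 * M)%:E.
Proof.
move=> M0; rewrite /A; under eq_integral do rewrite muleC.
rewrite ge0_integralZl//.
  by rewrite EFinM muleC; apply: lee_wpmul2r.
apply/measurable_EFinP; apply: measurableT_comp => //.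
by apply: (measurableT_comp mK); exact: measurable_pair1.
Qed.

(** Integrating the hypothesis and applying Tonelli, the integral of [`|w|] is
    at most half of itself. *)
Lemma Schur_contraction_eq0 (w : X -> R) : m.-integrable setT (EFin \o w) ->
  {ae m, forall t, `|w t|%:E <= \int[m]_s `|K (t, s) * w s|%:E} ->
  {ae m, forall t, w t = 0%R}.
Proof.
move=> iw ww.
have mw : measurable_fun setT (fun s => `|w s|%:E).
  by apply/measurable_EFinP; apply: measurableT_comp => //;
     apply/measurable_EFinP; exact: (measurable_int m iw).
have I : \int[m]_t `|w t|%:E <= (2^-1)%:E * \int[m]_t `|w t|%:E.
  apply: le_trans (intA mw _) => //.
  apply: ae_ge0_le_integral => //.
  - by move=> t _; apply: A_ge0.
  - exact: mA.
  apply: filterS ww => t + _; rewrite /A.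
  by under eq_integral do rewrite normrM EFinM.
have fI : \int[m]_t `|w t|%:E \is a fin_num.
  rewrite ge0_fin_numE; last exact: integral_ge0.
  by move/integrableP: iw => [_].
have I0 : \int[m]_t `|w t|%:E = 0.
  move: I; rewrite -(fineK fI) -EFinM lee_fin.
  have : (0 <= fine (\int[m]_t `|w t|%:E))%R.
    by apply: fine_ge0; apply: integral_ge0.
  by move=> h0 h1; congr EFin; lra.
have := (ae_eq_integral_abs m measurableT (measurable_int m iw)).1 I0.
by apply: filterS => t /(_ Logic.I) /= [].
Qed.

Context (g : X -> R) (ig : m.-integrable setT (EFin \o g)).

Let mg : measurable_fun setT g.
Proof. by apply/measurable_EFinP; exact: (measurable_int m ig). Qed.

(* Terms and partial sums of the dominating series: G n = A^n |g|. *)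
Let G n := iter n A (fun t => `|g t|%:E).

Let G_ge0 n t : 0 <= G n t.
Proof. by elim: n t => [|n IH] t //=; exact: A_ge0. Qed.

Let mG n : measurable_fun setT (G n).
Proof.
elim: n => [|n IH] /=; first by apply/measurable_EFinP; exact: measurableT_comp.
exact: mA.
Qed.

Let B (v : X -> R) t : R := (- \int[m]_s (K (t, s) * v s))%R.

(* Terms of the Neumann series of the equation u = g - Ku. *)
Let dn n := iter n B g.

Let mKv (v : X -> R) : measurable_fun setT v ->
  measurable_fun setT (fun z : X * X => (K z * v z.2)%R).
Proof.
move=> mv; apply: measurable_funM => //.
by apply: measurableT_comp => //; exact: measurable_snd.
Qed.

Let mKvt (v : X -> R) t : measurable_fun setT v ->
  measurable_fun setT (fun s => (K (t, s) * v s)%R).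
Proof.
move=> mv; apply: (measurableT_comp (mKv mv)); exact: measurable_pair1.
Qed.

Let absB (v : X -> R) t : measurable_fun setT v ->
  `|B v t|%:E <= A (fun s => `|v s|%:E) t.
Proof.
move=> mv; rewrite /B normrN.
have -> : A (fun s => `|v s|%:E) t = \int[m]_s `|(K (t, s) * v s)%:E|.
  by apply: eq_integral => s _; rewrite /= normrM EFinM.
apply: le_trans (le_abse_integral m measurableT _); last first.
  by apply/measurable_EFinP; exact: mKvt.
rewrite /Rintegral; case: (\int[m]_s (K (t, s) * v s)%:E) => [r| |] //=.
- exact: leey.
- exact: leey.
Qed.

Let iB (v : X -> R) : m.-integrable setT (EFin \o v) ->
  m.-integrable setT (EFin \o B v).
Proof.
move=> iv.
have mv : measurable_fun setT v.
  by apply/measurable_EFinP; exact: (measurable_int m iv).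
have mav : measurable_fun setT (fun s => `|v s|%:E).
  by apply/measurable_EFinP; exact: measurableT_comp.
have fav : \int[m]_s A (fun s => `|v s|%:E) s < +oo.
  apply: le_lt_trans (intA mav _) _ => //.
  move/integrableP: iv => [_ /= iv].
  have fI : \int[m]_t `|v t|%:E \is a fin_num.
    rewrite ge0_fin_numE; last exact: integral_ge0.
    exact: iv.
  by rewrite -(fineK fI) -EFinM ltry.
have mF : measurable_fun setT (fun t => \int[m]_s (K (t, s) * v s)%:E).
  apply: (measurable_fubini_F (m1 := m) (m2 := m)
    (f := fun z => (K z * v z.2)%:E)).
  apply/integrable12ltyP; first by apply/measurable_EFinP; exact: mKv.
  have -> : \int[m]_x \int[m]_y `|(K (x, y) * v y)%:E| =
            \int[m]_x A (fun s => `|v s|%:E) x.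
    apply: eq_integral => t _; apply: eq_integral => s _ /=.
    by rewrite normrM EFinM.
  exact: fav.
apply/integrableP; split.
  apply/measurable_EFinP; apply: measurable_funN => //.
  by apply: measurableT_comp; [exact: fine_measurable|exact: mF].
apply: le_lt_trans fav; apply: ge0_le_integral => //.
- apply: measurableT_comp => //.
  apply/measurable_EFinP; apply: measurable_funN => //.
  by apply: measurableT_comp; [exact: fine_measurable|exact: mF].
- exact: mA.
- by move=> t _; exact: absB.
Qed.

Let idn n : m.-integrable setT (EFin \o dn n).
Proof. by elim: n => [|n IH] //=; exact: iB. Qed.

Let mdn n : measurable_fun setT (dn n).
Proof. by apply/measurable_EFinP; exact: (measurable_int m (idn n)). Qed.

Let dnG n t : `|dn n t|%:E <= G n t.
Proof.
elim: n t => [|n IH] t //=.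
apply: le_trans (absB _ _) _ => //.
apply: leA => //; last exact: aeW.
by apply/measurable_EFinP; apply: measurableT_comp.
Qed.

Let S n t := \sum_(0 <= i < n) G i t.

Let S_ge0 n t : 0 <= S n t. Proof. exact: sume_ge0. Qed.

Let mS n : measurable_fun setT (S n).
Proof. exact: emeasurable_sum. Qed.

Let SS n t : S n.+1 t = `|g t|%:E + A (S n) t.
Proof.
rewrite /S big_nat_recl //=; congr (_ + _).
rewrite /A; under [RHS]eq_integral do rewrite ge0_sume_distrr//.
rewrite ge0_integral_sum//.
- by move=> i; exact: mKGt.
- by move=> i s _; rewrite mule_ge0.
Qed.

Let ndS t : nondecreasing_seq (S ^~ t).
Proof. by apply: ereal_nondecreasing_series. Qed.

Let U t := \sum_(n <oo) G n t.

Let U_ge0 t : 0 <= U t. Proof. exact: nneseries_ge0. Qed.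

Let SU n t : S n t <= U t. Proof. exact: nneseries_lim_ge. Qed.

Let mU : measurable_fun setT U.
Proof. exact: ge0_emeasurable_sum. Qed.

Let SlimU t : S ^~ t @ \oo --> U t.
Proof. exact: is_cvg_nneseries. Qed.

Let intU : \int[m]_t U t <= 2%:E * \int[m]_t `|g t|%:E.
Proof.
have fI : \int[m]_t `|g t|%:E \is a fin_num.
  rewrite ge0_fin_numE; last exact: integral_ge0.
  by move/integrableP: ig => [_].
have IS n : \int[m]_t S n t <= 2%:E * \int[m]_t `|g t|%:E.
  elim: n => [|n IH].
    rewrite (_ : \int[m]_t S 0 t = 0) ?mule_ge0 ?integral_ge0//.
    by under eq_integral do rewrite /S big_geq//; rewrite integral0.
  under eq_integral do rewrite SS.
  rewrite ge0_integralD//.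
  - have := intA (mS n) (S_ge0 n); rewrite -(fineK fI) => h.
    apply: (@le_trans _ _ ((fine (\int[m]_x `|g x|%:E))%:E + (2^-1)%:E * \int[m]_s S n s)).
      exact: leeD2l.
    apply: (@le_trans _ _ ((fine (\int[m]_x `|g x|%:E))%:E +
       (2^-1)%:E * (2%:E * (fine (\int[m]_x `|g x|%:E))%:E))).
      by apply: leeD2l; apply: lee_wpmul2l => //; rewrite (fineK fI).
    by rewrite -!EFinM -EFinD lee_fin; lra.
  - by apply/measurable_EFinP; exact: measurableT_comp.
  - by move=> x _; exact: A_ge0.
  - exact: mA.
have : \int[m]_t U t = limn (fun n => \int[m]_t S n t).
  by rewrite -monotone_convergence.
move=> ->; apply: lime_le; last exact: nearW.
apply: ereal_nondecreasing_is_cvgn => i j ij.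
by apply: ge0_le_integral => // t _; exact: ndS.
Qed.

Let aeU : {ae m, forall t, U t < +oo}.
Proof.
have iU : m.-integrable setT U.
  apply/integrableP; split => //.
  under eq_integral do rewrite gee0_abs//.
  apply: le_lt_trans intU _.
  rewrite lte_mul_pinfty//.
  by move/integrableP: ig => [_].
have := integrable_ae measurableT iU.
by apply: filterS => t /(_ Logic.I) /fin_numPlt /andP[].
Qed.

(* The partial sums satisfy S (n + 1) = |g| + A (S n), which preserves the
   bound 2 M because M + (1/2) (2 M) = 2 M. *)
Let supU (M : R) : (0 <= M)%R -> {ae m, forall t, (`|g t| <= M)%R} ->
  {ae m, forall t, U t <= (2 * M)%:E}.
Proof.
move=> M0 gM.
have SM n : {ae m, forall t, S n t <= (2 * M)%:E}.
  elim: n => [|n IH].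
    by apply: aeW => t; rewrite /S big_geq// lee_fin mulr_ge0.
  apply: filterS gM => t gtM; rewrite SS.
  apply: (@le_trans _ _ (M%:E + (2^-1 * (2 * M))%:E)).
    apply: leeD; first by rewrite lee_fin.
    apply: le_trans (Acst t _); last by rewrite mulr_ge0.
    by apply: leA => // s; rewrite lee_fin mulr_ge0.
  by rewrite -EFinD lee_fin; lra.
have : {ae m, forall t, forall n, S n t <= (2 * M)%:E}.
  by apply/ae_foralln => n; exact: SM.
apply: filterS => t St.
have -> : U t = limn (S ^~ t) by apply/esym/cvg_lim => //; exact: SlimU.
apply: lime_le; last exact: nearW.
by apply/cvg_ex; exists (U t); exact: SlimU.
Qed.

Let AU t : A U t <= U t.
Proof.
rewrite /A /U.
have -> : \int[m]_s (`|K (t, s)|%:E * \sum_(n <oo) G n s) = \sum_(n <oo) G n.+1 t.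
  rewrite -integral_nneseries//.
  - by apply: eq_integral => s _; rewrite nneseriesZl.
  - by move=> n; exact: mKGt.
  - by move=> n s _; rewrite mule_ge0.
rewrite [leRHS]nneseries_recl//.
under eq_eseriesr do rewrite -addn1.
by rewrite (@nneseries_addn _ (fun n => G n t))// leeDr.
Qed.

Let v n t : R := (\sum_(0 <= i < n) dn i t)%R.

Let v_ub n t : `|v n t|%:E <= U t.
Proof.
apply: le_trans (SU n t).
apply: (@le_trans _ _ (\sum_(0 <= i < n) `|dn i t|%:E)).
  by rewrite sumEFin lee_fin; exact: ler_norm_sum.
by apply: lee_sum => i _.
Qed.

Let cvg_v t : U t < +oo -> cvgn (v ^~ t).
Proof.
move=> Ut; apply: (@normed_cvg R R^o (dn ^~ t)).
apply: nondecreasing_is_cvgn; first exact: (@nondecreasing_series _ (fun i => `|dn i t|%R) xpredT 0%N).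
exists (fine (U t)) => _ [n _ <-] /=.
rewrite -lee_fin fineK ?ge0_fin_numE// /series/= -sumEFin.
by apply: le_trans (SU n t); apply: lee_sum.
Qed.

(* The default value 0 is taken on a null set only, by aeU. *)
Let u t : R := if U t < +oo then limn (v ^~ t) else 0%R.

Let v_u t : U t < +oo -> v ^~ t @ \oo --> u t.
Proof. by move=> Ut; rewrite /u Ut; exact: cvg_v. Qed.

Let u_ub t : `|u t|%:E <= U t.
Proof.
rewrite /u; case: ifPn => Ut; last by rewrite normr0.
have Uf : U t \is a fin_num by rewrite ge0_fin_numE.
rewrite -(fineK Uf) lee_fin.
have cv : `|v n t|%R @[n --> \oo] --> `|limn (v ^~ t)|%R.
  by apply: cvg_norm; exact: cvg_v.
rewrite -(cvg_lim _ cv)//; apply: limr_le; first by apply/cvg_ex; eexists; exact: cv.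
by apply: nearW => n; rewrite -lee_fin fineK.
Qed.

Let mu_ : measurable_fun setT u.
Proof.
pose D : set X := [set t | U t < +oo].
have mD : measurable D.
  by have := emeasurable_fun_infty_o measurableT mU +oo; rewrite setTI.
apply: (measurable_fun_cvg
  (h := fun n t => (v n t * (\1_D t : R))%R)).
- by move=> n; apply: measurable_funM => //; exact: measurable_sum.
- move=> t _; rewrite /u indicE; case: ifPn => Ut.
    by rewrite mem_set//; under eq_fun do rewrite mulr1; exact: cvg_v.
  rewrite memNset//=; last exact/negP.
  by under eq_fun do rewrite mulr0; exact: cvg_cst.
Qed.

Let fin2I : 2%:E * \int[m]_t `|g t|%:E < +oo.
Proof.
rewrite lte_mul_pinfty//.
by move/integrableP: ig => [_].
Qed.

Let intu : \int[m]_t `|u t|%:E <= 2%:E * \int[m]_t `|g t|%:E.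
Proof.
apply: le_trans intU; apply: ge0_le_integral => //.
by apply/measurable_EFinP; exact: measurableT_comp.
Qed.

Let iu : m.-integrable setT (EFin \o u).
Proof.
apply/integrableP; split; first exact/measurable_EFinP.
exact: le_lt_trans intu fin2I.
Qed.

Let vS n t : U t < +oo -> v n.+1 t = (g t - \int[m]_s (K (t, s) * v n s))%R.
Proof.
move=> Ut; rewrite /v big_nat_recl//=; congr (_ + _)%R.
have iKd i : m.-integrable setT (fun s => (K (t, s) * dn i s)%:E).
  apply/integrableP; split; first by apply/measurable_EFinP; exact: mKvt.
  apply: le_lt_trans (Ut); apply: le_trans (AU t).
  apply: ge0_le_integral => //.
  - by apply/measurable_EFinP; apply: measurableT_comp => //; exact: mKvt.
  - exact: mKGt.
  - move=> s _; rewrite /= normrM EFinM; apply: lee_wpmul2l => //.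
    apply: le_trans (dnG i s) _; apply: le_trans (SU i.+1 s).
    by rewrite /S big_nat_recr//= leeDr// sume_ge0.
rewrite /B sumrN; congr (- _)%R.
have E : \int[m]_s (K (t, s) * v n s)%:E =
    \sum_(0 <= i < n) \int[m]_s (K (t, s) * dn i s)%:E.
  rewrite -integral_sum//; apply: eq_integral => s _.
  by rewrite sumEFin mulr_sumr.
rewrite /Rintegral E.
rewrite (eq_bigr (fun i => (\int[m]_s (K (t, s) * dn i s))%:E)) ?sumEFin//.
by move=> i _; rewrite /Rintegral fineK//; exact: integrable_fin_num.
Qed.

Let u_eq t : U t < +oo -> u t = (g t - \int[m]_s (K (t, s) * u s))%R.
Proof.
move=> Ut.
have mKU : measurable_fun setT (fun s => `|K (t, s)|%:E * U s) by exact: mKGt.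
have iKU : m.-integrable setT (fun s => `|K (t, s)|%:E * U s).
  apply/integrableP; split=> //.
  under eq_integral do rewrite gee0_abs ?mule_ge0//.
  exact: le_lt_trans (AU t) Ut.
have mKv_ n : measurable_fun setT (fun s => (K (t, s) * v n s)%:E).
  by apply/measurable_EFinP; apply: mKvt; exact: measurable_sum.
have mKu : measurable_fun setT (fun s => (K (t, s) * u s)%:E).
  by apply/measurable_EFinP; exact: mKvt.
have lim_Kv : {ae m, forall s, [set: X] s ->
    (K (t, s) * v n s)%:E @[n --> \oo] --> (K (t, s) * u s)%:E}.
  apply: filterS aeU => s Us _; apply: cvg_EFin; first exact: nearW.
  by apply: cvgM; [exact: cvg_cst|exact: v_u].
have le_Kv : {ae m, forall s n, [set: X] s ->
    `|(K (t, s) * v n s)%:E| <= `|K (t, s)|%:E * U s}.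
  by apply: aeW => s n _; rewrite /= normrM EFinM; exact: lee_wpmul2l.
have [iKu _ c] := dominated_convergence measurableT mKv_ mKu lim_Kv iKU le_Kv.
have c1 : v n.+1 t @[n --> \oo] --> (g t - \int[m]_s (K (t, s) * u s))%R.
  under eq_fun do rewrite vS//.
  apply: cvgB; first exact: cvg_cst.
  by apply: fine_cvg; rewrite fineK//; exact: integrable_fin_num.
have := v_u Ut; rewrite -cvg_shiftS => c0.
exact: (cvg_unique _ c0 c1).
Qed.

(** The Neumann series is dominated by [U], the sum of the iterates of the
    positive operator on [`|g|]. This series satisfies both bounds, so it is
    finite almost everywhere and the Neumann series converges there; the
    equation follows by dominated convergence. *)
Lemma Schur_resolvent : exists u : X -> R,
  [/\ m.-integrable setT (EFin \o u),
      {ae m, forall t, u t = (g t - \int[m]_s (K (t, s) * u s))%R},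
      \int[m]_t `|u t|%:E <= 2%:E * \int[m]_t `|g t|%:E &
      forall M : R, (0 <= M)%R -> {ae m, forall t, (`|g t| <= M)%R} ->
        {ae m, forall t, (`|u t| <= 2 * M)%R}].
Proof.
exists u; split=> //.
- by apply: filterS aeU => t; exact: u_eq.
- move=> M M0 /(supU M0); apply: filterS => t.
  by rewrite -lee_fin; exact: le_trans.
Qed.

End Schur.

(** * Euler's Gamma function *)

Section GammaFunction.
Context {R : realType}.
Local Notation mu := (@lebesgue_measure R).
Implicit Types x y s p : R.

Let J : set R := `]0, +oo[.

Let g p s : R := s `^ p * expR (- s).

Let mJ : measurable J.
Proof. exact: measurable_itv. Qed.

Lemma is_derive_continuous (f : R -> R) (x df : R) :
  is_derive x 1 f df -> {for x, continuous f}.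
Proof.
by move=> dfx; apply/differentiable_continuous/derivable1_diffP; exact: ex_derive.
Qed.

Lemma powR_continuous p s : 0 < s -> {for s, continuous (fun t => t `^ p)}.
Proof. by move=> s0; exact: is_derive_continuous (is_derive1_powR p s0). Qed.

Lemma expRN_continuous : continuous (fun s : R => expR (- s)).
Proof.
by move=> s; apply: continuous_comp; [exact: opp_continuous|exact: continuous_expR].
Qed.

Lemma is_derive_expRZ (c s : R) :
  is_derive s 1 (fun t : R => expR (c * t)) (c * expR (c * s)).
Proof.
have d : is_derive s 1 (fun t : R => c * t) c.
  have := is_deriveZ c (is_derive_id s (1 : R)).
  by rewrite /GRing.scale/= mulr1.
have := @is_derive1_comp _ expR (fun t : R => c * t) s _ _ (is_derive_expR (c * s)) d.
by rewrite mulrC.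
Qed.

Lemma cvgy_expRZ : expR (- 2^-1 * s) @[s --> +oo] --> (0 : R).
Proof.
under eq_fun do rewrite mulNr.
apply: (@cvg_comp _ _ _ (fun s : R => 2^-1 * s) (fun s => expR (- s)) _ +oo).
  by apply: gt0_cvgMry => //; exact: cvg_id.
exact: cvgr_expR.
Qed.

Let cg p s : 0 < s -> {for s, continuous (g p)}.
Proof.
by move=> s0; apply: cvgM; [exact: powR_continuous|exact: expRN_continuous].
Qed.

Let mgJ p : measurable_fun J (g p).
Proof.
apply: measurable_funM.
  by apply: measurable_funTS; exact: measurable_powR.
apply: measurable_funTS; apply: measurableT_comp => //.
Qed.

Let g_ge0 p s : 0 <= g p s.
Proof. by rewrite mulr_ge0 ?powR_ge0 ?expR_ge0. Qed.

(** One term of the exponential series is enough, with exponent an integer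
    above [p]. *)
Lemma powR_le_expR p : exists2 C : R, 0 < C &
  forall s, 1 <= s -> s `^ p <= C * expR (s / 2).
Proof.
pose n := (Num.truncn p).+1.
exists (2 ^+ n * n`!%:R).
  by rewrite mulr_gt0 ?exprn_gt0 ?ltr0n ?fact_gt0.
move=> s s1; apply: (@le_trans _ _ (s `^ n%:R)).
  by apply: ler_powR => //; exact: ltW (truncnS_gt _).
have s0 : 0 <= s by lra.
rewrite powR_mulrn//.
have := @expR_ge1Dxn R (s / 2) n.-1 ltac:(lra).
rewrite /= -/n expr_div_n => h.
have h' : s ^+ n / 2 ^+ n / n`!%:R <= expR (s / 2) by apply: le_trans h; lra.
have f0 : 0 < (n`!%:R : R) by rewrite ltr0n fact_gt0.
have t0 : 0 < (2 ^+ n : R) by rewrite exprn_gt0.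
move: h'; rewrite ler_pdivrMr// ler_pdivrMr// => h'.
by rewrite (_ : 2 ^+ n * n`!%:R * _ = expR (s / 2) * n`!%:R * 2 ^+ n)//; ring.
Qed.

Lemma integrable_powR p b : -1 < p -> 0 < b ->
  mu.-integrable `]0, b] (EFin \o (fun s => s `^ p)).
Proof.
move=> p1 b0.
have mp : measurable_fun (`]0, b] : set R) (fun s : R => s `^ p).
  by apply: measurable_funTS; exact: measurable_powR.
apply/integrableP; split; first exact/measurable_EFinP.
under eq_integral do rewrite /= ger0_norm ?powR_ge0//.
pose F s : R := (p + 1)^-1 * s `^ (p + 1).
suff -> : (\int[mu]_(s in `]0%R, b]) (s `^ p)%:E = (F b - 0)%:E)%E by rewrite ltry.
apply: ge0_FTC_oc => //.
- move=> s /andP[s0 _].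
  have d := @is_derive1_powR R (p + 1) s s0.
  have := is_deriveZ (p + 1)^-1 d.
  rewrite addrK /GRing.scale/= mulrA mulVf ?mul1r//; lra.
- by move=> s /andP[s0 _]; exact: powR_continuous.
- rewrite -[X in _ --> X](mulr0 (p + 1)^-1).
  apply: cvgM; first exact: cvg_cst.
  by apply: powR_cvg0; lra.
- by move=> s _; exact: powR_ge0.
Qed.

(** Comparison with [s `^ (x - 1)] on [`]0, 1]] and with a multiple of
    [expR (- s / 2)] beyond. *)
Lemma Gamma_integrable x : 0 < x ->
  mu.-integrable `]0, +oo[ (EFin \o (fun s => s `^ (x - 1) * expR (- s))).
Proof.
move=> x0; rewrite -/(g (x - 1)).
have Jsplit : J = `]0, 1] `|` `]1, +oo[.
  apply/seteqP; split=> s; rewrite /J/= !in_itv/= !andbT.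
    by move=> s0; case: (leP s 1) => s1; [left|right]; rewrite ?s0.
  by move=> [/andP[]//|]; exact: lt_trans.
apply/integrableP; split; first by apply/measurable_EFinP; exact: mgJ.
rewrite -/J Jsplit ge0_integral_setU//=; last 2 first.
- apply/measurable_EFinP; apply: measurableT_comp => //.
  by rewrite -Jsplit; exact: mgJ.
- apply/disj_setPS => s /=; rewrite !in_itv/= andbT => -[/andP[_ s1] s2].
  by move: s1; rewrite leNgt s2.
rewrite lte_add_pinfty//.
  have /integrableP[_] := @integrable_powR (x - 1) 1 ltac:(lra) ltr01.
  apply: le_lt_trans; apply: ge0_le_integral => //.
  - apply/measurable_EFinP; apply: measurableT_comp => //.
    by apply: measurable_funS (@mgJ (x - 1)) => //; rewrite Jsplit; left.
  - apply/measurable_EFinP; apply: measurableT_comp => //.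
    by apply: measurable_funTS; exact: measurable_powR.
  - move=> s; rewrite /= in_itv/= => /andP[s0 _]; rewrite lee_fin.
    rewrite normrM ler_piMr// ger0_norm ?expR_ge0//.
    by rewrite expR_le1; lra.
have [C C0 hC] := powR_le_expR (x - 1).
have E : (\int[mu]_(s in `[1%R, +oo[) (C * expR (- 2^-1 * s))%:E =
    0%:E - (- 2 * C * expR (- 2^-1 * 1))%:E)%E.
  have dF (s : R) : is_derive s 1 (fun t => - 2 * C * expR (- 2^-1 * t))
      (C * expR (- 2^-1 * s)).
    have := is_deriveZ (- 2 * C) (is_derive_expRZ (- 2^-1) s).
    rewrite /GRing.scale/=.
    by rewrite (_ : - 2 * C * _ = C * expR (- 2^-1 * s)); last lra.
  apply: (@ge0_continuous_FTC2y _ (fun s => C * expR (- 2^-1 * s))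
      (fun s => - 2 * C * expR (- 2^-1 * s))).
  - by move=> s _; rewrite mulr_ge0 ?expR_ge0 ?ltW.
  - apply: continuous_subspaceT => s.
    have := is_derive_expRZ (- 2^-1) s => /is_derive_continuous h.
    by apply: cvgM; [exact: cvg_cst|exact: h].
  - rewrite -[X in _ --> X](mulr0 (- 2 * C)).
    by apply: cvgM; [exact: cvg_cst|exact: cvgy_expRZ].
  - by move=> s _; exact: ex_derive.
  - by apply: cvg_at_right_filter; exact: is_derive_continuous (dF 1).
  - by move=> s _; rewrite derive1E derive_val.
have m1J : measurable_fun (`]1, +oo[ : set R) (EFin \o (fun s => C * expR (- 2^-1 * s))).
  apply/measurable_EFinP; apply: measurable_funM => //.
  by apply: measurable_funTS; apply: measurableT_comp => //; exact: measurable_funM.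
apply: (@le_lt_trans _ _ (\int[mu]_(s in `]1%R, +oo[) (C * expR (- 2^-1 * s))%:E)%E).
  apply: ge0_le_integral => //.
  - apply/measurable_EFinP; apply: measurableT_comp => //.
    by apply: measurable_funS (@mgJ (x - 1)) => //; rewrite Jsplit; right.
  - move=> s; rewrite /= in_itv/= andbT => s1; rewrite lee_fin.
    rewrite ger0_norm ?g_ge0//.
    rewrite (_ : - 2^-1 * s = s / 2 - s); last by lra.
    rewrite expRD mulrA ler_wpM2r ?expR_ge0// hC// ltW//.
rewrite integral_itv_obnd_cbnd//.
by rewrite E -EFinB ltry.
Qed.

Lemma cvgy_Gamma_integrand p : s `^ p * expR (- s) @[s --> +oo] --> 0.
Proof.
have [C C0 hC] := powR_le_expR p.
apply: (@squeeze_cvgr _ _ _ _ (cst 0) (fun s => C * expR (- 2^-1 * s))).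
- exists 1; split=> // s s1; rewrite g_ge0/=.
  rewrite (_ : - 2^-1 * s = s / 2 - s); last by lra.
  by rewrite expRD mulrA ler_wpM2r ?expR_ge0// hC// ltW.
- exact: cvg_cst.
- rewrite -[X in _ --> X](mulr0 C).
  by apply: cvgM; [exact: cvg_cst|exact: cvgy_expRZ].
Qed.

Lemma is_derive_Gamma_integrand p s : 0 < s ->
  is_derive s 1 (g p) (p * g (p - 1) s - g p s).
Proof.
move=> s0.
have d1 := @is_derive1_powR R p s s0.
have d2 := is_derive_expRZ (- 1) s.
have E : g p = (fun t => t `^ p) * (fun t => expR (- 1 * t)).
  by apply/funext => t; rewrite /g -[in expR (- t)]mulN1r.
rewrite [X in is_derive _ _ X _]E.
apply: (is_derive_eq (is_deriveM d1 d2)).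
by rewrite /GRing.scale/= !mulN1r /g; ring.
Qed.

(** Integration by parts: the derivative of [s `^ x * expR (- s)], which
    vanishes at both ends, has integral 0. *)
Lemma GammaS x : 0 < x -> Gamma (x + 1) = x * Gamma x.
Proof.
move=> x0.
have i1 := Gamma_integrable x0.
have i2 : mu.-integrable J (EFin \o (fun s => s `^ x * expR (- s))).
  by have := @Gamma_integrable (x + 1) ltac:(lra); rewrite addrK.
have i3 : mu.-integrable J (EFin \o (fun s => x * g (x - 1) s)).
  by have := @integrableZl _ _ _ mu J (measurable_itv _) x _ i1.
have i4 : mu.-integrable J (EFin \o (fun s => x * g (x - 1) s - g x s)).
  by have := @integrableB _ _ _ mu J (measurable_itv _) _ _ i3 i2.
have := @FTC_oy R (fun s => x * g (x - 1) s - g x s) (g x) 0 0.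
move=> /(_ (@is_derive_Gamma_integrand x))/(_ _)/(_ _)/(_ (@cvgy_Gamma_integrand x) i4).
have c s : 0 < s -> {for s, continuous (fun s => x * g (x - 1) s - g x s)}.
  move=> s0; apply: cvgB; last exact: cg.
  by apply: cvgM; [exact: cvg_cst|exact: cg].
have z : g x s @[s --> 0^'+] --> 0.
  rewrite -[X in _ --> X](mul0r (expR (- 0))).
  apply: cvgM; first exact: powR_cvg0.
  by apply: cvg_at_right_filter; exact: expRN_continuous.
move=> /(_ c z) E.
rewrite /Gamma -RintegralZl//.
have : \int[mu]_(s in J) (x * g (x - 1) s - g x s) = 0 by rewrite /Rintegral E subrr.
rewrite (@RintegralB _ _ R mu J (fun s => x * g (x - 1) s) (g x) mJ i3 i2) => /eqP; rewrite subr_eq0 => /eqP ->.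
by rewrite addrK.
Qed.

Lemma Gamma_gt0 x : 0 < x -> 0 < Gamma x.
Proof.
move=> x0.
have ix := Gamma_integrable x0.
pose c : R := 2^-1 * expR (- 2).
have c0 : 0 < c by rewrite mulr_gt0 ?expR_gt0.
have sub : `[1, 2]%classic `<=` J.
  by move=> s; rewrite /J/= !in_itv/= andbT => /andP[s1 _]; lra.
have ifin := @integrable_fin_num _ _ _ mu J mJ _ ix.
have I0 : (0 <= \int[mu]_(s in J) (g (x - 1) s)%:E)%E.
  by apply: integral_ge0 => s _; rewrite lee_fin g_ge0.
apply: fine_gt0; rewrite -(ge0_fin_numE I0) ifin andbT.
apply: (@lt_le_trans _ _ (\int[mu]_(s in `[1%R, 2%R]) c%:E)%E).
  rewrite integral_cst//= lebesgue_measure_itv/= lte_fin ltr1n/=.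
  by rewrite -EFinB -EFinM lte_fin mulr_gt0//; lra.
apply: (@le_trans _ _ (\int[mu]_(s in `[1%R, 2%R]) (g (x - 1) s)%:E)%E).
  apply: ge0_le_integral => //.
  - by move=> s _; rewrite lee_fin ltW.
  - by apply/measurable_EFinP; exact: measurable_funS (@mgJ (x - 1)).
  - move=> s; rewrite /= in_itv/= => /andP[s1 s2]; rewrite lee_fin.
    apply: ler_pM => //.
    + apply: (@le_trans _ _ (s `^ (- 1))).
        by rewrite powR_inv1; [rewrite lef_pV2 ?posrE//; lra|lra].
      by apply: ler_powR => //; lra.
    + by rewrite ler_expR; lra.
apply: ge0_subset_integral => //.
- by apply/measurable_EFinP; exact: mgJ.
- by move=> s _; rewrite lee_fin g_ge0.
Qed.

(** This is the sublinearity of the logarithm at [s `^ (- e)]. *)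
Lemma ln_le_powRN (e s : R) : 0 < e -> 0 < s <= 1 -> `|ln s| <= e^-1 * s `^ (- e).
Proof.
move=> e0 /andP[s0 s1].
rewrite ler0_norm ?ln_le0// -ler_pdivrMl ?invr_gt0// invrK.
rewrite mulrN -mulNr -ln_powR.
by apply: ltW; apply: ln_sublinear; exact: powR_gt0.
Qed.

Let pow_le (u v y s : R) : u < y < v -> 0 < s -> s `^ y <= s `^ u + s `^ v.
Proof.
move=> /andP[uy yv] s0; case: (leP s 1) => s1.
  rewrite (@le_trans _ _ (s `^ u))// ?lerDl ?powR_ge0//.
  by apply: ger_powR; [rewrite s0|exact: ltW].
rewrite (@le_trans _ _ (s `^ v))// ?lerDr ?powR_ge0//.
by apply: ler_powR; exact: ltW.
Qed.

Let ln_le (e s : R) : 0 < e -> 0 < s -> `|ln s| <= e^-1 * s `^ (- e) + s `^ 1.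
Proof.
move=> e0 s0; case: (leP s 1) => s1.
  rewrite (le_trans (@ln_le_powRN e s e0 _)) ?s0//.
  by rewrite lerDl powR_ge0.
rewrite ger0_norm; last by apply: ln_ge0; exact: ltW.
apply: (@le_trans _ _ s); first exact: ltW (ln_sublinear s0).
rewrite powRr1 ?(ltW s0)// lerDr mulr_ge0 ?powR_ge0// invr_ge0.
exact: ltW.
Qed.

Definition dGamma_integrand x s : R := ln s * (s `^ (x - 1) * expR (- s)).

Definition dGamma x : R := \int[mu]_(s in `]0, +oo[) dGamma_integrand x s.

(* For exponents y between u and v, the derivative of the Gamma integrand is
   dominated near 0 by the power u - 1 lowered by u / 2, which absorbs the
   logarithm, and near infinity by the power v, one unit of which absorbs it. *)
Let dom (u v s : R) : R := (2 / u * g (u / 2 - 1) s + 2 / u * g (v - u / 2 - 1) s)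
  + (g u s + g v s).

Let dom_ge0 (u v s : R) : 0 < u -> 0 <= dom u v s.
Proof.
move=> u0; have c : 0 <= 2 / u by rewrite divr_ge0// ltW.
by apply: addr_ge0; apply: addr_ge0 => //; apply: mulr_ge0.
Qed.

Let dom_int (u v : R) : 0 < u < v -> mu.-integrable J (EFin \o dom u v).
Proof.
move=> /andP[u0 uv].
have ig p : -1 < p -> mu.-integrable J (EFin \o g p).
  move=> p1; have := @Gamma_integrable (p + 1) ltac:(lra).
  by rewrite addrK.
have i1 : mu.-integrable J (EFin \o (fun s => 2 / u * g (u / 2 - 1) s)).
  exact: (@integrableZl _ _ _ mu J mJ (2 / u) _ (ig (u / 2 - 1) ltac:(lra))).
have i2 : mu.-integrable J (EFin \o (fun s => 2 / u * g (v - u / 2 - 1) s)).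
  exact: (@integrableZl _ _ _ mu J mJ (2 / u) _ (ig (v - u / 2 - 1) ltac:(lra))).
have i3 := ig u ltac:(lra).
have i4 := ig v ltac:(lra).
exact: (@integrableD _ _ _ mu J mJ _ _ (@integrableD _ _ _ mu J mJ _ _ i1 i2)
  (@integrableD _ _ _ mu J mJ _ _ i3 i4)).
Qed.

Let dom_ub (u v y s : R) : 0 < u -> u < y < v -> 0 < s ->
  `|dGamma_integrand y s| <= dom u v s.
Proof.
move=> u0 /andP[uy yv] s0.
rewrite /dGamma_integrand normrM (ger0_norm (g_ge0 (y - 1) s)).
have h1 := @ln_le (u / 2) s ltac:(lra) s0.
have h2 : s `^ (y - 1) <= s `^ (u - 1) + s `^ (v - 1).
  by apply: pow_le => //; lra.
apply: (@le_trans _ _ (((u / 2)^-1 * s `^ (- (u / 2)) + s `^ 1) *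
    ((s `^ (u - 1) + s `^ (v - 1)) * expR (- s)))).
  by apply: ler_pM => //; rewrite ler_wpM2r ?expR_ge0.
have mulp (p q : R) : s `^ p * s `^ q = s `^ (p + q).
  by rewrite powRD// (gt_eqF s0) implybT.
rewrite /dom /g.
have -> : s `^ (u / 2 - 1) = s `^ (- (u / 2)) * s `^ (u - 1).
  by rewrite mulp; congr powR; lra.
have -> : s `^ (v - u / 2 - 1) = s `^ (- (u / 2)) * s `^ (v - 1).
  by rewrite mulp; congr powR; lra.
have -> : s `^ u = s `^ 1 * s `^ (u - 1) by rewrite mulp; congr powR; lra.
have -> : s `^ v = s `^ 1 * s `^ (v - 1) by rewrite mulp; congr powR; lra.
by rewrite invf_div le_eqVlt; apply/orP; left; apply/eqP; ring.
Qed.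

Let is_derive_pow_exponent s y : 0 < s ->
  is_derive y 1 (fun x => s `^ (x - 1) * expR (- s)) (dGamma_integrand y s).
Proof.
move=> s0.
have E : (fun x => s `^ (x - 1) * expR (- s)) =
    (fun x => (s `^ (- 1) * expR (- s)) * expR (ln s * x)).
  apply/funext => x; rewrite (_ : x - 1 = - 1 + x); last by lra.
  rewrite powRD ?(gt_eqF s0) ?implybT// [s `^ x]/powR (gt_eqF s0).
  by rewrite [x * _]mulrC; ring.
rewrite E; apply: (is_derive_eq (is_deriveZ _ (is_derive_expRZ (ln s) y))).
have /(congr1 (@^~ y)) /= := E.
by rewrite /GRing.scale/= /dGamma_integrand => ->; ring.
Qed.

Let mdJ y : measurable_fun J (dGamma_integrand y).
Proof.
apply: measurable_funM; last exact: mgJ.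
by apply: measurable_funTS; exact: measurable_ln.
Qed.

Let int_d y : 0 < y -> mu.-integrable J (EFin \o dGamma_integrand y).
Proof.
move=> y0.
have yv : 0 < y / 2 < y + 1 by lra.
apply: (@le_integrable _ _ _ mu J mJ _ (EFin \o dom (y / 2) (y + 1)) _ _ (dom_int yv)).
  by apply/measurable_EFinP; exact: mdJ.
move=> s; rewrite /J/= in_itv/= andbT => s0; rewrite lee_fin.
rewrite (ger0_norm (dom_ge0 _ _ _)); last by lra.
by apply: dom_ub => //; lra.
Qed.

(** Differentiation under the integral sign. *)
Lemma is_derive_Gamma x : 0 < x -> is_derive x 1 Gamma (dGamma x).
Proof.
move=> x0.
pose f (y s : R) := s `^ (y - 1) * expR (- s).
pose u := x / 2; pose v := x + 1.
have Ix : `]u, v[%classic x by rewrite /= in_itv/= /u /v; lra.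
have intf y : `]u, v[%classic y -> mu.-integrable J (EFin \o f y).
  by rewrite /= in_itv/= /u /v => y0; apply: Gamma_integrable; lra.
have df y s : `]u, v[%classic y -> J s -> derivable (f ^~ s) y 1.
  rewrite /J/= !in_itv/= andbT => _ s0.
  by have := is_derive_pow_exponent y s0; move=> ?; exact: ex_derive.
have d1E y s : 0 < s -> partial1of2 f y s = dGamma_integrand y s.
  move=> s0; have := is_derive_pow_exponent y s0.
  by rewrite /partial1of2 derive1E => ?; rewrite derive_val.
have Gub y s : `]u, v[%classic y -> J s -> `|partial1of2 f y s| <= dom u v s.
  rewrite /J/= !in_itv/= andbT => yuv s0; rewrite d1E//.
  by apply: dom_ub => //; rewrite /u; lra.
have uv : 0 < u < v by rewrite /u /v; lra.
have dge s : 0 <= dom u v s by apply: dom_ge0; lra.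
have D := @derivable_under_integral R _ _ mu f J mJ x u v Ix intf df
  (dom u v) dge (dom_int uv) Gub.
have E := @differentiation_under_integral R _ _ mu f J mJ x u v Ix intf df
  (dom u v) dge (dom_int uv) Gub.
apply: DeriveDef; first exact: D.
rewrite -derive1E; transitivity (\int[mu]_(s in J) (partial1of2 f ^~ s) x).
  exact: E.
apply: eq_Rintegral => s; rewrite inE /J/= in_itv/= andbT => s0.
exact: d1E.
Qed.

Lemma dGamma_continuous x : 0 < x -> {for x, continuous dGamma}.
Proof.
move=> x0.
pose u := x / 2; pose v := x + 1.
have uv : 0 < u < v by rewrite /u /v; lra.
have Ix : x \in `]u, v[%classic by rewrite inE/= in_itv/= /u /v; lra.
apply: (@continuity_under_integral R _ _ mu dGamma_integrand J mJ u v _ _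
  (dom u v) (dom_int uv) _ x Ix).
- by move=> y; rewrite /= in_itv/= /u => yuv; apply: int_d; lra.
- apply: aeW => s; rewrite /J/= in_itv/= andbT => s0 y _.
  apply: cvgM; first exact: cvg_cst.
  exact: is_derive_continuous (is_derive_pow_exponent y s0).
- move=> y; rewrite /= in_itv/= => yuv; apply: aeW => s.
  rewrite /J/= in_itv/= andbT => s0; apply: dom_ub => //.
  by rewrite /u; lra.
Qed.

End GammaFunction.

(** * Smooth steps *)

Lemma is_deriveV {R : realType} (f : R -> R) (x df : R) : f x != 0 ->
  is_derive x 1 f df -> is_derive x 1 (fun y => (f y)^-1) (- (f x) ^- 2 * df).
Proof.
move=> fx0 dfx; apply: DeriveDef; first by apply: derivableV => //; exact: ex_derive.
by rewrite deriveV// derive_val.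
Qed.

(** The functions [p (1 / x) * exp (- 1 / x)], extended by 0 to [x <= 0], are
    stable under derivation because the coefficient [p] is an arbitrary
    polynomial. *)
Section FlatFunctions.
Context {R : realType}.
Implicit Types (p q : {poly R}) (x y h : R).

Definition flat p x : R := if 0 < x then p.[x^-1] * expR (- x^-1) else 0.

Definition dflat p : {poly R} := 'X^2 * (p - p^`()).

(* Induction on the polynomial, with an extra power of y to absorb the
   multiplication by the variable. *)
Let poly_expR_bound p n :
  exists C : R, forall y, 1 <= y -> `|y ^+ n * p.[y]| * expR (- y) <= C.
Proof.
elim/poly_ind: p n => [|p c IH] n.
  by exists 0 => y _; rewrite horner0 mulr0 normr0 mul0r.
have [C hC] := IH n.+1.
exists (C + `|c| * n.+1`!%:R) => y y1.
have y0 : 0 <= y by lra.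
rewrite hornerMXaddC mulrDr (_ : y ^+ n * (p.[y] * y) = y ^+ n.+1 * p.[y]); last first.
  by rewrite exprS; ring.
apply: (@le_trans _ _ ((`|y ^+ n.+1 * p.[y]| + `|y ^+ n * c|) * expR (- y))).
  by rewrite ler_wpM2r ?expR_ge0// ler_normD.
rewrite mulrDl lerD ?hC//.
rewrite normrM [`|y ^+ n| * _]mulrC -mulrA ler_wpM2l//.
rewrite ger0_norm ?exprn_ge0// expRN ler_pdivrMr ?expR_gt0//.
apply: (@le_trans _ _ (y ^+ n.+1)); first by rewrite exprS ler_peMl ?exprn_ge0.
have := @expR_ge1Dxn R y n y0 => h.
have f0 : 0 < (n.+1`!%:R : R) by rewrite ltr0n fact_gt0.
have : y ^+ n.+1 / n.+1`!%:R <= expR y by apply: le_trans h; lra.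
by rewrite ler_pdivrMr// mulrC.
Qed.

(* The bound at 0 is linear only, but it applies to every polynomial; in
   particular to 'X * p, whose flat function is the difference quotient. *)
Let flat_bound p : exists C : R, forall h, `|h| < 1 -> `|flat p h| <= C * `|h|.
Proof.
have [C hC] := poly_expR_bound p 1.
have C0 : 0 <= C by apply: le_trans (hC 1 _) => //; rewrite mulr_ge0 ?expR_ge0.
exists C => h h1; rewrite /flat; case: ifPn => h0; last by rewrite normr0 mulr_ge0.
rewrite (ger0_norm (ltW h0)) in h1 *.
have y1 : 1 <= h^-1 by rewrite invf_ge1// ltW.
have := hC _ y1; rewrite expr1 !normrM (ger0_norm (expR_ge0 _)).
rewrite (@ger0_norm _ h^-1); last by rewrite invr_ge0 ltW.
by rewrite -mulrA ler_pdivrMl// [h * _]mulrC.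
Qed.

Lemma flat_ge0 x : 0 <= flat 1 x.
Proof. by rewrite /flat; case: ifP => // _; rewrite hornerC mul1r expR_ge0. Qed.

Lemma flat_gt0 x : 0 < x -> 0 < flat 1 x.
Proof. by move=> x0; rewrite /flat x0 hornerC mul1r expR_gt0. Qed.

Lemma flat_le0 p x : x <= 0 -> flat p x = 0.
Proof. by move=> x0; rewrite /flat ltNge x0. Qed.

Let is_derive_flat_gt0 p x : 0 < x -> is_derive x 1 (flat p) (flat (dflat p) x).
Proof.
move=> x0.
have xN0 : x != 0 by rewrite gt_eqF.
have dV : is_derive x 1 (fun x : R => x^-1) (- x ^- 2).
  by have := is_deriveV xN0 (is_derive_id x 1); rewrite mulr1.
have dp : is_derive x 1 (fun x : R => p.[x^-1]) (p^`().[x^-1] * (- x ^- 2)).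
  exact: (@is_derive1_comp _ (horner p) (fun x : R => x^-1) x _ _ (is_derive_poly p x^-1) dV).
have de : is_derive x 1 (fun x : R => expR (- x^-1)) (expR (- x^-1) * (x ^- 2)).
  have dN : is_derive x 1 (fun x : R => - x^-1) (x ^- 2).
    by have := is_deriveN dV; rewrite opprK.
  exact: (@is_derive1_comp _ expR (fun x : R => - x^-1) x _ _ (is_derive_expR _) dN).
have d := is_deriveM dp de.
apply: (@near_eq_is_derive _ _ _ (fun x => p.[x^-1] * expR (- x^-1))) => //.
  near=> y; rewrite /flat ifT//; near: y.
  exact: lt_nbhsr.
apply: (is_derive_eq d).
rewrite /flat x0 /dflat /GRing.scale/= hornerM hornerXn hornerD hornerN exprVn.
ring.
Unshelve. all: end_near. Qed.

Lemma is_derive_flat p x : is_derive x 1 (flat p) (flat (dflat p) x).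
Proof.
have [x0|x0|->] := ltgtP x 0; last 1 first.
- rewrite [X in is_derive _ _ _ X]flat_le0//.
  have [C hC] := flat_bound ('X * p).
  have c : h^-1 *: (flat p (h *: 1 + 0) - flat p 0) @[h --> 0^'] --> (0 : R).
    apply/cvgrPdist_le => e e0; near=> h; rewrite sub0r normrN.
    have hN0 : h != 0 by near: h; exact: nbhs_dnbhs_neq.
    have -> : h^-1 *: (flat p (h *: 1 + 0) - flat p 0) = flat ('X * p) h.
      rewrite (flat_le0 p (lexx 0)) subr0 addr0 /GRing.scale/= mulr1 /flat.
      by case: ifPn => h0; [rewrite hornerM hornerX; ring|rewrite mulr0].
    have h1 : `|h| < 1 by near: h; exact: dnbhs0_lt.
    apply: (le_trans (hC _ h1)).
    apply: (@le_trans _ _ ((`|C| + 1) * `|h|)).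
      by rewrite ler_wpM2r// (le_trans (ler_norm C))// lerDl.
    have C0 : 0 < `|C| + 1 by rewrite ltr_wpDl.
    rewrite -ler_pdivlMl//; apply: ltW; near: h; apply: dnbhs0_lt.
    by rewrite mulr_gt0 ?invr_gt0.
  apply: DeriveDef.
    by apply/cvg_ex; exists 0.
  exact/cvg_lim.
- rewrite [X in is_derive _ _ _ X]flat_le0 ?ltW//.
  have dc : is_derive x 1 (cst 0 : R -> R) 0 by exact: is_derive_cst.
  apply: near_eq_is_derive dc.
  near=> y; rewrite flat_le0//; by apply: ltW; near: y; exact: lt_nbhsl.
- exact: is_derive_flat_gt0.
Unshelve. all: end_near. Qed.

End FlatFunctions.

Section SmoothStep.
Context {R : realType}.
Local Notation mu := (@lebesgue_measure R).
Implicit Types (p q : {poly R}) (x k c e : R).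

Definition bump x : R := flat 1 x * flat 1 (1 - x).

Lemma bump_ge0 x : 0 <= bump x.
Proof. by rewrite mulr_ge0 ?flat_ge0. Qed.

Lemma bump_out x : (x <= 0) || (1 <= x) -> bump x = 0.
Proof.
move=> /orP[x0|x1]; rewrite /bump; first by rewrite flat_le0 ?mul0r.
by rewrite (@flat_le0 _ _ (1 - x)) ?mulr0// subr_le0.
Qed.

Let flat_continuous p : continuous (flat p).
Proof. by move=> x; exact: is_derive_continuous (is_derive_flat p x). Qed.

Lemma bump_continuous : continuous bump.
Proof.
move=> x; apply: cvgM; first exact: flat_continuous.
apply: (@continuous_comp _ _ _ (fun t : R => 1 - t) (flat 1)); last exact: flat_continuous.
by apply: cvgB; [exact: cvg_cst|exact: cvg_id].
Qed.

Let bump_restrict : bump = bump \_ `[0, 1].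
Proof.
apply/funext => x; rewrite /patch; case: ifPn => //.
rewrite notin_setE/= in_itv/= => /negP; rewrite negb_and -!ltNge => h.
apply: bump_out.
by move: h => /orP[/ltW ->//|/ltW ->]; rewrite orbT.
Qed.

Lemma bump_integrable (D : set R) : measurable D -> mu.-integrable D (EFin \o bump).
Proof.
move=> mD; apply: (@integrableS _ (measurableTypeR R) _ mu setT) => //.
rewrite bump_restrict -restrict_EFin.
have mI : measurable (`[0, 1] : set (measurableTypeR R)) by exact: measurable_itv.
apply: (@integrable_mkcond _ (measurableTypeR R) R mu _ _ mI).1.
apply: continuous_compact_integrable; first exact: segment_compact.
by apply: continuous_subspaceT; exact: bump_continuous.
Qed.

(** A multiple of the usual smooth step: it increases from 0 at 0 to a positive
    value at 1 and is constant on each side of [`[0, 1]]. *)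
Definition step x : R := \int[mu]_(t in `]-oo, x]) bump t.

Lemma is_derive_step x : is_derive x 1 step (bump x).
Proof.
have x1 : x < x + 1 by lra.
have ib : mu.-integrable `]-oo, (x + 1)] (EFin \o bump).
  by apply: bump_integrable; exact: measurable_itv.
have [||] := @continuous_FTC1 R bump (BInfty R true) x (x + 1) x1 ib.
- exact: ltNyr.
- exact: bump_continuous.
by move=> d <-; rewrite derive1E; exact: DeriveDef.
Qed.

Let step_continuous : continuous step.
Proof. by move=> x; exact: is_derive_continuous (is_derive_step x). Qed.

Let step_MVT x y : x <= y -> exists2 z, x <= z <= y & step y - step x = bump z * (y - x).
Proof.
move=> xy.
have d (z : R) : z \in `]x, y[ -> is_derive z 1 step (bump z).
  by move=> _; exact: is_derive_step.
have [z zxy E] := MVT_segment xy d (continuous_subspaceT step_continuous).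
by exists z.
Qed.

Lemma step_le0 x : x <= 0 -> step x = 0.
Proof.
move=> x0; rewrite /step (@eq_Rintegral _ _ _ _ _ (cst 0)).
  by rewrite /Rintegral integral0.
move=> y; rewrite inE/= in_itv/= => yx.
by rewrite bump_out//= (le_trans yx x0).
Qed.

Lemma step_ge1 x : 1 <= x -> step x = step 1.
Proof.
move=> x1; have [z /andP[z1 _]] := step_MVT x1.
by rewrite bump_out ?z1 ?orbT// mul0r => /eqP; rewrite subr_eq0 => /eqP.
Qed.

Lemma step1_gt0 : 0 < step 1.
Proof.
have d (z : R) : z \in `]0, 1[ -> is_derive z 1 step (bump z).
  by move=> _; exact: is_derive_step.
have [z zxy E] := MVT ltr01 d (continuous_subspaceT step_continuous).
move: E zxy; rewrite (step_le0 (lexx 0)) !subr0 mulr1 in_itv/= => -> /andP[z0 z1].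
by rewrite mulr_gt0// flat_gt0// subr_gt0.
Qed.

Lemma step_bounds x : 0 <= step x <= step 1.
Proof.
have nd y z : y <= z -> step y <= step z.
  move=> yz; have [t _ E] := step_MVT yz.
  by rewrite -subr_ge0 E mulr_ge0 ?bump_ge0// subr_ge0.
apply/andP; split.
  case: (leP 0 x) => x0; first by rewrite -(step_le0 (lexx 0)) nd.
  by rewrite step_le0// ltW.
by case: (leP x 1) => x1; [exact: nd|rewrite step_ge1// ltW].
Qed.

(** A class of functions which contains the test functions used below and which
    is stable under derivation, so that its elements are smooth. *)
Inductive smooth_span : (R -> R) -> Prop :=
| smooth_bump p q k c e :
    smooth_span (fun x => e * (flat p (k * (x - c)) * flat q (1 - k * (x - c))))
| smooth_step k c e : smooth_span (fun x => e * step (k * (x - c)))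
| smooth_add f g : smooth_span f -> smooth_span g -> smooth_span (f \+ g).

Let is_derive_affine k c x (f df : R -> R) : (forall y : R, is_derive y 1 f (df y)) ->
  is_derive x 1 (fun t : R => f (k * (t - c))) (k * df (k * (x - c))).
Proof.
move=> dF.
have d : is_derive x 1 (fun t : R => k * (t - c)) k.
  have d0 : is_derive x 1 (fun t : R => t - c) (1 - 0).
    exact: (is_deriveB (is_derive_id x 1) (is_derive_cst c x 1)).
  by have := is_deriveZ k d0; rewrite /GRing.scale/= subr0 mulr1.
have := @is_derive1_comp _ f (fun t : R => k * (t - c)) x _ _ (dF _) d.
by rewrite mulrC.
Qed.

Lemma smooth_span_derive f : smooth_span f ->
  exists2 g, smooth_span g & forall x : R, is_derive x 1 f (g x).
Proof.
elim=> {f} [p q k c e|k c e|f1 f2 _ [g1 G1 d1] _ [g2 G2 d2]].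
- exists ((fun x => (e * k) * (flat (dflat p) (k * (x - c)) * flat q (1 - k * (x - c)))) \+
    (fun x => (- (e * k)) * (flat p (k * (x - c)) * flat (dflat q) (1 - k * (x - c))))).
    by apply: smooth_add; exact: smooth_bump.
  move=> x.
  have dp := @is_derive_affine k c x _ _ (is_derive_flat p).
  have dq0 (y : R) : is_derive y 1 (fun t : R => flat q (1 - t)) (- flat (dflat q) (1 - y)).
    have d : is_derive y 1 (fun t : R => 1 - t) (0 - 1).
      exact: (is_deriveB (is_derive_cst (1 : R) y 1) (is_derive_id y 1)).
    have := @is_derive1_comp _ (flat q) (fun t : R => 1 - t) y _ _ (is_derive_flat q _) d.
    by rewrite sub0r mulrN1.
  have dq := @is_derive_affine k c x _ _ dq0.
  have := is_deriveZ e (is_deriveM dp dq).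
  move=> D; apply: (is_derive_eq D).
  by rewrite /GRing.scale/=; ring.
- exists (fun x => (e * k) * (flat 1 (k * (x - c)) * flat 1 (1 - k * (x - c)))).
    exact: smooth_bump.
  move=> x; have := is_deriveZ e (@is_derive_affine k c x _ _ is_derive_step).
  by move=> D; apply: (is_derive_eq D); rewrite /GRing.scale/= /bump; ring.
- exists (g1 \+ g2); first exact: smooth_add.
  by move=> x; exact: is_deriveD (d1 x) (d2 x).
Qed.

Lemma smooth_span_derivable f : smooth_span f ->
  forall n (x : R), derivable (f^`(n))%classic x 1.
Proof.
move=> Sf n; suff : smooth_span (f^`(n))%classic.
  by move=> /smooth_span_derive[g _ dg] x; exact: ex_derive.
elim: n => [|n IH]; first by rewrite derive1n0.
have [g Sg dg] := smooth_span_derive IH.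
rewrite derive1nS (_ : _^`()%classic = g)//.
by apply/funext => x; rewrite derive1E derive_val.
Qed.

End SmoothStep.

(** * Primitives of weak derivatives *)

Section WeakDerivative.
Context {R : realType}.
Local Notation mu := (@lebesgue_measure R).
Implicit Types (f g : R -> R) (x k c d t : R).

Lemma within_continuous_seq (A : set R) f (u : nat -> R) x :
  {within A, continuous f} -> A x -> (forall n, A (u n)) ->
  u n @[n --> \oo] --> x -> f (u n) @[n --> \oo] --> f x.
Proof.
move=> /subspace_continuousP cf Ax Au ux.
apply: cvg_comp (cf x Ax).
by move=> B /ux [N _ hN]; exists N => // n Nn; apply: (hN n Nn); exact: Au.
Qed.

Lemma bump_le1 x : bump x <= 1.
Proof.
have flat_le1 y : flat 1 y <= (1 : R).
  rewrite /flat; case: ifPn => // y0; rewrite hornerC mul1r expR_le1 oppr_le0.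
  by rewrite invr_ge0 ltW.
by rewrite /bump -[leRHS]mulr1; apply: ler_pM => //; exact: flat_ge0.
Qed.

(* An approximation of unity times step 1, with support [c, c + 1 / k]; it is
   the derivative of a rescaled step. *)
Let mollifier k c x : R := k * bump (k * (x - c)).

Let mollifier_ge0 k c x : 0 < k -> 0 <= mollifier k c x.
Proof. by move=> k0; rewrite mulr_ge0 ?bump_ge0// ltW. Qed.

Let mollifier_out k c x : 0 < k -> (x <= c) || (c + k^-1 <= x) -> mollifier k c x = 0.
Proof.
move=> k0 h; rewrite /mollifier bump_out ?mulr0//.
case/orP: h => h; apply/orP; [left|right].
  by rewrite pmulr_rle0// subr_le0.
by rewrite -ler_pdivrMl// mulr1 lerBrDl.
Qed.

Let mollifier_continuous k c : continuous (mollifier k c).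
Proof.
move=> x; apply: cvgM; first exact: cvg_cst.
apply: (@continuous_comp _ _ _ (fun t => k * (t - c)) bump); last exact: bump_continuous.
apply: cvgM; first exact: cvg_cst.
by apply: cvgB; [exact: cvg_id|exact: cvg_cst].
Qed.

Let is_derive_step_affine k c x : is_derive x 1 (fun t => step (k * (t - c))) (mollifier k c x).
Proof.
have d : is_derive x 1 (fun t : R => k * (t - c)) k.
  have d0 : is_derive x 1 (fun t : R => t - c) (1 - 0).
    exact: (is_deriveB (is_derive_id x 1) (is_derive_cst c x 1)).
  by have := is_deriveZ k d0; rewrite /GRing.scale/= subr0 mulr1.
have := @is_derive1_comp _ step (fun t : R => k * (t - c)) x _ _ (is_derive_step _) d.
by rewrite mulrC.
Qed.

Let mollifier_integral (T : R) k c : 0 < c -> 0 < k -> c + k^-1 < T ->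
  (\int[mu]_(x in `]0%R, T[) (mollifier k c x)%:E = (step 1)%:E)%E.
Proof.
move=> c0 k0 ckT.
have T0 : 0 < T by apply: lt_trans ckT; rewrite addr_gt0// invr_gt0.
rewrite -(@integral_itv_bndoo R 0 T _ true false); last first.
  apply/measurable_EFinP; apply: measurable_funTS.
  by apply: continuous_measurable_fun; exact: mollifier_continuous.
have dF x := is_derive_step_affine k c x.
rewrite (@continuous_FTC2 R (mollifier k c) (fun t => step (k * (t - c))) 0 T T0).
- rewrite (@step_le0 _ (k * (0 - c))); last by rewrite sub0r mulrN oppr_le0 mulr_ge0 ?ltW.
  rewrite (@step_ge1 _ (k * (T - c))) ?sube0//.
  by rewrite -ler_pdivrMl// mulr1 lerBrDl ltW.
- by apply: continuous_subspaceT; exact: mollifier_continuous.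
- split.
  + by move=> x _; have := dF x => ?; exact: ex_derive.
  + by apply: cvg_at_right_filter; exact: is_derive_continuous (dF 0).
  + by apply: cvg_at_left_filter; exact: is_derive_continuous (dF T).
- by move=> x _; have := dF x => ?; rewrite derive1E derive_val.
Qed.

Let I0T_measurable (T : R) : measurable (`]0, T[ : set R).
Proof. exact: measurable_itv. Qed.

Let mollifier_int (T : R) k c f : 0 < k -> L1 T f ->
  mu.-integrable `]0, T[ (EFin \o (fun x => f x * mollifier k c x)).
Proof.
move=> k0 fi.
have ikf : mu.-integrable `]0, T[ (fun x => k%:E * (EFin \o f) x)%E.
  exact: (@integrableZl _ _ _ mu _ (I0T_measurable T) k _ fi).
apply: (@le_integrable _ _ _ mu _ (I0T_measurable T) _ _ _ _ ikf).
  apply/measurable_EFinP; apply: measurable_funM.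
    by apply/measurable_EFinP; exact: (measurable_int mu fi).
  apply: measurable_funTS.
  by apply: continuous_measurable_fun; exact: mollifier_continuous.
move=> x _; rewrite -EFinM lee_fin [leLHS]normrM [leRHS]normrM mulrC ler_wpM2r//.
rewrite [leLHS]normrM -[leRHS]mulr1 ler_wpM2l// ger0_norm ?bump_le1//.
exact: bump_ge0.
Qed.

Let cvg_mollifier (T : R) f c (k_ : nat -> R) : 0 < c < T -> L1 T f ->
  {for c, continuous f} -> (forall n, 0 < k_ n) -> k_ n @[n --> \oo] --> +oo ->
  \int[mu]_(x in `]0, T[) (f x * mollifier (k_ n) c x) @[n --> \oo] --> f c * step 1.
Proof.
move=> /andP[c0 cT] fi cf k0 koo.
have m0 : 0 < step 1 :> R := step1_gt0.
apply/cvgrPdist_le => e e0.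
have e'0 : 0 < e / step 1 by rewrite divr_gt0.
have [del /= del0 hdel] := (cvgrPdist_le _ _).1 cf _ e'0.
have M0 : 0 < Num.min del (T - c) by rewrite lt_min del0 subr_gt0.
near=> n.
pose k := k_ n.
have kn0 : 0 < k by exact: k0.
have k1 : k^-1 < Num.min del (T - c).
  rewrite invf_plt ?posrE//.
  by rewrite /k; near: n; exact: cvgry_gt.
have [k1d k1T] : k^-1 < del /\ c + k^-1 < T.
  by move: k1; rewrite lt_min => /andP[-> h]; split => //; lra.
have mker : measurable_fun (`]0, T[ : set R) (mollifier k c).
  apply: measurable_funTS.
  by apply: continuous_measurable_fun; exact: mollifier_continuous.
have ik : mu.-integrable `]0, T[ (EFin \o mollifier k c).
  apply/integrableP; split; first exact/measurable_EFinP.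
  under eq_integral do rewrite /= ger0_norm ?mollifier_ge0//.
  by rewrite mollifier_integral// ltry.
have ifk := @mollifier_int T k c f kn0 fi.
have ick : mu.-integrable `]0, T[ (EFin \o (fun x => f c * mollifier k c x)).
  exact: (@integrableZl _ _ _ mu _ (I0T_measurable T) (f c) _ ik).
have E : f c * step 1 = \int[mu]_(x in `]0, T[) (f c * mollifier k c x).
  rewrite (@RintegralZl _ _ _ mu _ _ _ (I0T_measurable T) ik).
  by rewrite /Rintegral mollifier_integral.
rewrite E -(@RintegralB _ _ _ mu _ _ _ (I0T_measurable T) ick ifk).
have ibk := @integrableB _ _ _ mu _ (I0T_measurable T) _ _ ick ifk.
apply: (le_trans (@le_normr_Rintegral _ _ _ mu _ _ (I0T_measurable T) ibk)).
have iek : mu.-integrable `]0, T[ (EFin \o (fun x => e / step 1 * mollifier k c x)).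
  exact: (@integrableZl _ _ _ mu _ (I0T_measurable T) (e / step 1) _ ik).
apply: (@le_trans _ _ (\int[mu]_(x in `]0, T[) (e / step 1 * mollifier k c x))).
  apply: (@le_Rintegral _ _ _ mu _ _ _ (I0T_measurable T)) => //.
    exact: (@integrable_norm _ _ _ mu _ _ ibk).
  move=> x _; rewrite -mulrBl normrM (ger0_norm (mollifier_ge0 _ _ kn0)).
  case: (boolP ((x <= c) || (c + k^-1 <= x))) => h.
    by rewrite mollifier_out// !mulr0.
  move: h; rewrite negb_or -!ltNge => /andP[h1 h2].
  rewrite ler_wpM2r ?mollifier_ge0//.
  by apply: hdel; rewrite /= ltr_norml; lra.
rewrite (@RintegralZl _ _ _ mu _ _ _ (I0T_measurable T) ik).
by rewrite /Rintegral mollifier_integral//= divfK// gt_eqF.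
Unshelve. all: end_near. Qed.

(* The coefficients 1 and -1 are explicit to match the constructors of
   smooth_span. *)
Let cutoff k c d : R -> R :=
  (fun x => 1 * step (k * (x - c))) \+ (fun x => (- 1) * step (k * (x - d))).

Let cutoffE k c d x : cutoff k c d x = step (k * (x - c)) - step (k * (x - d)).
Proof. by rewrite /cutoff/= mul1r mulN1r. Qed.

Let cutoff_derive k c d x : (cutoff k c d)^`()%classic x = mollifier k c x - mollifier k d x.
Proof.
have -> : cutoff k c d = (fun x => step (k * (x - c))) - (fun x => step (k * (x - d))).
  by apply/funext => y; rewrite cutoffE.
have := is_deriveB (is_derive_step_affine k c x) (is_derive_step_affine k d x).
by move=> ?; rewrite derive1E derive_val.
Qed.

Let cutoff_bound k c d x : `|cutoff k c d x| <= step 1.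
Proof.
have /andP[a0 a1] := step_bounds (k * (x - c)).
have /andP[b0 b1] := step_bounds (k * (x - d)).
by rewrite cutoffE ler_norml; lra.
Qed.

Let cutoff_test (T k c d : R) : 0 < c < d -> 0 < k -> d + k^-1 < T ->
  test_function T (cutoff k c d).
Proof.
move=> /andP[c0 cd] k0 dT.
have sub : [set x | cutoff k c d x != 0] `<=` `[c, d + k^-1].
  move=> x /=; rewrite cutoffE in_itv/=; apply: contraR.
  rewrite negb_and -!ltNge => /orP[xc|xd].
    by rewrite !step_le0 ?subrr// pmulr_rle0//; lra.
  have kx y : y <= d -> 1 <= k * (x - y).
    by move=> yd; rewrite -ler_pdivrMl// mulr1; lra.
  by rewrite !(step_ge1 (kx _ _)) ?subrr//; lra.
have csub : closure [set x | cutoff k c d x != 0] `<=` `[c, d + k^-1].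
  by rewrite [X in _ `<=` X](closure_id _).1; [exact: closure_subset|exact: interval_closed].
split.
- apply: smooth_span_derivable; apply: smooth_add; exact: smooth_step.
- apply: (subclosed_compact _ (@segment_compact _ c (d + k^-1))) => //.
  exact: closed_closure.
- move=> x /csub; rewrite /= !in_itv/= => /andP[cx xd]; apply/andP; split; lra.
Qed.

Let cvg_cutoff (k_ : nat -> R) c d x : c < d -> (forall n, 0 < k_ n) ->
  k_ n @[n --> \oo] --> +oo ->
  cutoff (k_ n) c d x @[n --> \oo] --> step 1 * \1_`]c, d] x.
Proof.
move=> cd k0 koo.
have step_cvg y : step (k_ n * (x - y)) @[n --> \oo] --> step 1 * (y < x)%R%:R.
  case: ltP => yx.
    rewrite mulr1; apply: cvg_near_cst; near=> n.
    apply: step_ge1; rewrite -ler_pdivrMr ?subr_gt0// mul1r.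
    by near: n; exact: cvgry_ge.
  rewrite mulr0; apply: cvg_near_cst; near=> n.
  by apply: step_le0; rewrite pmulr_rle0// subr_le0.
rewrite (_ : step 1 * _ = step 1 * (c < x)%R%:R - step 1 * (d < x)%R%:R).
  by under eq_fun do rewrite cutoffE; apply: cvgB; exact: step_cvg.
rewrite indicE mem_setE in_itv/= -mulrBr; congr (_ * _).
case: ltP => xc/=; last by rewrite (ltNge d) (le_trans xc (ltW cd)) subrr.
by case: leP => _; rewrite ?subr0 ?subrr.
Unshelve. all: end_near. Qed.

(** The weak derivative is tested against smooth approximations of [step 1]
    times the indicator of [`]c, d]]: their derivatives concentrate at [c] and
    [d] and give [f c] and [f d] by continuity, and the other side converges by
    dominated convergence. *)
Lemma W11_increment (T : R) f g c d : 0 < c < d -> d < T -> W11 T f g ->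
  f d - f c = \int[mu]_(x in `]0, T[) (g x * \1_`]c, d] x).
Proof.
move=> /andP[c0 cd] dT [fi gi wd cf].
pose k_ n : R := n.+2%:R / (T - d).
have Td0 : 0 < T - d by rewrite subr_gt0.
have k0 n : 0 < k_ n by rewrite divr_gt0.
have kT n : d + (k_ n)^-1 < T.
  rewrite invf_div -ltrBrDl ltr_pdivrMr// ltr_pMr// ltr1n//.
have koo : k_ n @[n --> \oo] --> +oo.
  apply/cvgryPge => A; exists (Num.truncn (A * (T - d))) => // n /= An.
  rewrite ler_pdivlMr//; apply: (le_trans (ltW (truncnS_gt _))).
  by rewrite ler_nat ltnS; exact: leq_trans An (leqnSn _).
have contf t : 0 < t < T -> {for t, continuous f}.
  move=> t0T.
  have : {within `]0, T[, continuous f}.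
    by apply: continuous_subspaceW cf; exact: subset_itv_oo_cc.
  rewrite continuous_open_subspace; last exact: interval_open.
  by apply; rewrite inE/= in_itv/=.
have m0 : 0 < step 1 :> R := step1_gt0.
have mg : measurable_fun (`]0, T[ : set R) g.
  by apply/measurable_EFinP; exact: (measurable_int mu gi).
have mI : measurable_fun (`]0, T[ : set R) (\1_(`]c, d] : set R) : R -> R).
  by apply: measurable_indic; exact: measurable_itv.
have int_indic1 : mu.-integrable `]0, T[ (EFin \o (fun x => g x * \1_`]c, d] x)).
  apply: (@le_integrable _ _ _ mu _ (I0T_measurable T) _ (EFin \o g)) => //.
    by apply/measurable_EFinP; exact: measurable_funM.
  move=> x _; rewrite lee_fin normrM ler_piMr// indicE.
  by case: (_ \in _); rewrite ?normr1 ?normr0.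
have int_indic : mu.-integrable `]0, T[
    (EFin \o (fun x => g x * (step 1 * \1_`]c, d] x))).
  have := @integrableZl _ _ _ mu _ (I0T_measurable T) (step 1) _ int_indic1.
  apply: eq_integrable; first exact: I0T_measurable.
  by move=> x _; rewrite /= -EFinM mulrCA.
have l1 : \int[mu]_(x in `]0, T[) (f x * (cutoff (k_ n) c d)^`()%classic x)
    @[n --> \oo] --> f c * step 1 - f d * step 1.
  under eq_fun => n.
    rewrite (@eq_Rintegral _ _ _ mu _ (fun x => f x * mollifier (k_ n) c x - f x * mollifier (k_ n) d x)).
      rewrite (@RintegralB _ _ _ mu _ _ _ (I0T_measurable T)); [over| |].
      + exact: mollifier_int.
      + exact: mollifier_int.
    by move=> x _; rewrite cutoff_derive mulrBr.
  apply: cvgB; apply: cvg_mollifier => //.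
  - by rewrite c0 (lt_trans cd dT).
  - by apply: contf; rewrite c0 (lt_trans cd dT).
  - by rewrite (lt_trans c0 cd).
  - by apply: contf; rewrite (lt_trans c0 cd).
have l2 : \int[mu]_(x in `]0, T[) (g x * cutoff (k_ n) c d x)
    @[n --> \oo] --> \int[mu]_(x in `]0, T[) (g x * (step 1 * \1_`]c, d] x)).
  apply: fine_cvg; rewrite fineK; last first.
    apply: (@integrable_fin_num _ _ _ mu _ (I0T_measurable T)).
    exact: int_indic.
  apply: (@dominated_cvg _ _ _ mu _ (I0T_measurable T)
    (fun n x => (g x * cutoff (k_ n) c d x)%:E) _ (fun x => (step 1 * `|g x|)%:E)) => //.
  - move=> n; apply/measurable_EFinP; apply: measurable_funM => //.
    apply: measurable_funTS; apply: continuous_measurable_fun => x.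
    rewrite (_ : cutoff (k_ n) c d = (fun x => step (k_ n * (x - c))) \- (fun x => step (k_ n * (x - d)))).
      apply: cvgB; exact: is_derive_continuous (is_derive_step_affine _ _ _).
    by apply/funext => y; rewrite cutoffE.
  - move=> x _; apply: cvg_EFin; first exact: nearW.
    by apply: cvgM; [exact: cvg_cst|exact: cvg_cutoff].
  - exact: (@integrableZl _ _ _ mu _ (I0T_measurable T) (step 1) _ (integrable_norm gi)).
  - move=> n x _; rewrite lee_fin normrM mulrC ler_wpM2r//.
have e n : \int[mu]_(x in `]0, T[) (f x * (cutoff (k_ n) c d)^`()%classic x) =
    - \int[mu]_(x in `]0, T[) (g x * cutoff (k_ n) c d x).
  by apply: wd; apply: cutoff_test => //; rewrite c0.
have l3 : (- (\int[mu]_(x in `]0, T[) (g x * cutoff (k_ n) c d x)))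
    @[n --> \oo] --> f c * step 1 - f d * step 1.
  by under eq_fun do rewrite -e.
have : f c * step 1 - f d * step 1 =
    - (\int[mu]_(x in `]0, T[) (g x * (step 1 * \1_`]c, d] x))).
  exact: (cvg_unique _ l3 (cvgN l2)).
under eq_Rintegral do rewrite mulrCA.
rewrite (@RintegralZl _ _ _ mu _ _ _ (I0T_measurable T)); last exact: int_indic1.
move=> E; apply: (mulIf (lt0r_neq0 m0)); rewrite mulrBl.
by move: E; lra.
Qed.

(** The increments over segments inside [`]0, T[] are known; let their ends tend
    to 0 and [t]. Up to the boundary, this uses continuity of [f] on [`[0, T]]
    and integrability of [g]. *)
Lemma W11_integral (T : R) f g t : 0 < T -> W11 T f g -> f 0 = 0 ->
  t \in `[0, T] -> f t = \int[mu]_(x in `]0, t[) g x.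
Proof.
move=> T0 wfg f0; have [fi gi wd cf] := wfg.
rewrite in_itv/= => /andP[]; rewrite le_eqVlt => /predU1P[<- _|t0 tT].
  by rewrite f0 set_itvoo0 Rintegral_set0.
pose e_ n := t / n.+3%:R.
have e0 n : 0 < e_ n by rewrite divr_gt0.
have et n : e_ n < t - e_ n.
  have hN : 2 < n.+3%:R :> R by rewrite ltr_nat.
  have E : e_ n * n.+3%:R = t by rewrite /e_ divfK.
  rewrite -subr_gt0 (_ : _ - _ = e_ n * (n.+3%:R - 2)); last by rewrite mulrBr E; ring.
  by rewrite mulr_gt0// subr_gt0.
have elim : e_ n @[n --> \oo] --> (0 : R).
  rewrite /e_ -(mulr0 t); apply: cvgM; first exact: cvg_cst.
  have := @cvg_harmonic R; rewrite -(cvg_shiftS (@harmonic R)).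
  by rewrite -(cvg_shiftS (fun n => @harmonic R n.+1)).
have c0 : f (e_ n) @[n --> \oo] --> f 0.
  apply: (within_continuous_seq cf) => //=.
  - by rewrite in_itv/= lexx ltW.
  - by move=> n; rewrite in_itv/=; have := et n; have := e0 n; lra.
have c1 : f (t - e_ n) @[n --> \oo] --> f t.
  apply: (within_continuous_seq cf) => //=.
  - by rewrite in_itv/= tT ltW.
  - by move=> n; rewrite in_itv/=; have := et n; have := e0 n; lra.
  - by rewrite -[X in _ --> X]subr0; apply: cvgB; [exact: cvg_cst|exact: elim].
have mg : measurable_fun (`]0, T[ : set R) g.
  by apply/measurable_EFinP; exact: (measurable_int mu gi).
have int_indic (A : set R) : measurable A ->
    mu.-integrable `]0, T[ (EFin \o (fun x => g x * \1_A x)).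
  move=> mA; apply: (@le_integrable _ _ _ mu _ (I0T_measurable T) _ (EFin \o g)) => //.
    by apply/measurable_EFinP; apply: measurable_funM => //; exact: measurable_indic.
  move=> x _; rewrite lee_fin normrM ler_piMr// indicE.
  by case: (_ \in _); rewrite ?normr1 ?normr0.
have c2 : \int[mu]_(x in `]0, T[) (g x * \1_`]e_ n, t - e_ n] x)
    @[n --> \oo] --> \int[mu]_(x in `]0, T[) (g x * \1_`]0, t[ x).
  apply: fine_cvg; rewrite fineK; last first.
    apply: (@integrable_fin_num _ _ _ mu _ (I0T_measurable T)).
    by apply: int_indic; exact: measurable_itv.
  apply: (@dominated_cvg _ _ _ mu _ (I0T_measurable T)
    (fun n x => (g x * \1_`]e_ n, t - e_ n] x)%:E) _ (fun x => `|g x|%:E)) => //.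
  - move=> n; apply: (measurable_int mu (int_indic _ _)).
    exact: measurable_itv.
  - move=> x _; apply: cvg_EFin; first exact: nearW.
    apply: cvgM; first exact: cvg_cst.
    rewrite !indicE; apply: cvg_near_cst.
    have [|x0t] := boolP (x \in `]0, t[%classic).
      rewrite inE/= in_itv/= => /andP[x0 xt].
      near=> n; rewrite indicE mem_set//= in_itv/=; apply/andP; split.
        by near: n; exact: (cvgr_lt _ elim).
      rewrite lerBrDl -lerBrDr; apply: ltW; near: n.
      by apply: (cvgr_lt _ elim); rewrite subr_gt0.
    apply: nearW => n; rewrite indicE memNset//= in_itv/=.
    move=> /andP[x1 x2]; move/negP: x0t; apply; rewrite inE/= in_itv/=.
    by have en := e0 n; apply/andP; split; lra.
  - exact: integrable_norm.
  - move=> n x _; rewrite lee_fin normrM ler_piMr// indicE.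
    by case: (_ \in _); rewrite ?normr1 ?normr0.
have E n : f (t - e_ n) - f (e_ n) =
    \int[mu]_(x in `]0, T[) (g x * \1_`]e_ n, t - e_ n] x).
  apply: W11_increment wfg; first by rewrite e0 et.
  by have := e0 n; lra.
have c3 : f (t - e_ n) - f (e_ n) @[n --> \oo] --> f t - f 0 by exact: cvgB.
have : f t - f 0 = \int[mu]_(x in `]0, T[) (g x * \1_`]0, t[ x).
  by move: c2; under eq_fun do rewrite -E; exact: cvg_unique.
rewrite f0 subr0 => ->.
rewrite [RHS]Rintegral_mkcond [LHS]Rintegral_mkcond.
apply: eq_Rintegral => x _; rewrite /patch indicE.
have [xt|xt] := boolP (x \in `]0, t[%classic); last by rewrite mulr0 if_same.
rewrite mulr1 ifT//; move: xt; rewrite !inE/= !in_itv/= => /andP[-> xt].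
exact: lt_le_trans xt tT.
Unshelve. all: end_near. Qed.

End WeakDerivative.

(** * The Abel kernel near the origin *)

Lemma norm_between {R : realType} (x y z : R) : z <= x -> x <= y -> `|x| <= `|y| + `|z|.
Proof.
move=> zx xy; have := ler_norm y; have := ler_norm (- z); rewrite normrN => h1 h2.
have := normr_ge0 y; have := normr_ge0 z => h3 h4.
by rewrite ler_norml; apply/andP; split; lra.
Qed.

Lemma inverse_bounds {R : realType} (g0 g d D l M : R) : 0 < g0 -> g0 <= g ->
  `|d| <= D -> `|l| <= M ->
  `|g^-1| <= g0^-1 + g0 ^- 2 * D /\ `|- g ^- 2 * (d * l)| <= (g0^-1 + g0 ^- 2 * D) * M.
Proof.
move=> g00 g0g dD lM.
have gt0 : 0 < g by exact: lt_le_trans g0g.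
have D0 : 0 <= D by exact: le_trans dD.
have hV : g^-1 <= g0^-1 by rewrite lef_pV2.
have sq0 : 0 <= g0 ^- 2 by rewrite invr_ge0 exprn_ge0// ltW.
split.
  rewrite ger0_norm ?invr_ge0 ?(ltW gt0)//.
  by rewrite (le_trans hV)// lerDl mulr_ge0.
rewrite mulNr normrN mulrA normrM ler_pM// normrM.
rewrite (@ger0_norm _ (_ ^- 2)); last by rewrite invr_ge0 exprn_ge0// ltW.
apply: (@le_trans _ _ (g0 ^- 2 * D)); last by rewrite lerDr invr_ge0 ltW.
apply: ler_pM => //; first by rewrite invr_ge0 exprn_ge0// ltW.
rewrite lef_pV2 ?posrE ?exprn_gt0//.
by apply: lerXn2r => //; rewrite nnegrE ltW.
Qed.

(** Here [b] stands for [1 - a]; the limit [kappa0] of its slopes is its one-sided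
    derivative at 0. *)
Section AbelKernel.
Context {R : realType}.
Local Notation mu := (@lebesgue_measure R).
Context (T L kappa0 : R) (b b1 b2 : R -> R).
Hypothesis T_gt0 : 0 < T.
Hypothesis L_gt0 : 0 < L.
Hypothesis db : forall t : R, 0 < t < T -> is_derive t 1 b (b1 t).
Hypothesis db1 : forall t : R, 0 < t < T -> is_derive t 1 b1 (b2 t).
Hypothesis b1_bound : forall t : R, 0 < t < T -> `|b1 t| <= L.
Hypothesis b2_bound : forall t : R, 0 < t < T -> `|b2 t| <= L.
Hypothesis b_01 : forall t : R, 0 < t < T -> 0 < b t < 1.
Hypothesis b_slope : b t / t @[t --> 0^'+] --> kappa0.

Let near0T (P : R -> Prop) : (forall t : R, 0 < t < T -> P t) -> \forall t \near 0^'+, P t.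
Proof.
move=> h; near=> t; apply: h; apply/andP; split.
  by near: t; exact: nbhs_right_gt.
by near: t; exact: nbhs_right_lt.
Unshelve. all: end_near. Qed.

Let b_cvg0 : b t @[t --> 0^'+] --> 0.
Proof.
rewrite -[X in _ --> X](mulr0 kappa0).
have h : b t / t * t @[t --> 0^'+] --> kappa0 * 0.
  by apply: cvgM => //; apply: cvg_at_right_filter; exact: cvg_id.
apply: cvg_trans h; apply: near_eq_cvg; apply: near0T => t /andP[t0 _].
by rewrite divfK// gt_eqF.
Qed.

(* The mean value theorem on [0, t]; b is set to 0 on the left of 0, so that
   its value at 0 is its right limit there. *)
Let b_MVT (t : R) : 0 < t < T -> exists2 x : R, 0 < x < t & b t = t * b1 x.
Proof.
move=> /andP[t0 tT].
pose B x : R := if x <= 0 then 0 else b x.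
have BE x : 0 < x -> B x = b x by rewrite /B leNgt => ->.
have dB (x : R) : x \in `]0, t[ -> is_derive x 1 B (b1 x).
  rewrite in_itv/= => /andP[x0 xt].
  have d : is_derive x 1 b (b1 x) by apply: db; rewrite x0 (lt_trans xt).
  apply: near_eq_is_derive d; near=> y; rewrite BE//; near: y; exact: lt_nbhsr.
have cB : {within `[0, t], continuous B}.
  apply: derivable_oo_LRcontinuous_within; split.
  - by move=> x xt; have := dB x xt => ?; exact: ex_derive.
  - rewrite {2}/B lexx; apply: cvg_trans b_cvg0; apply: near_eq_cvg.
    by apply: near0T => x /andP[x0 _]; rewrite BE.
  - rewrite BE//; have d : is_derive t 1 b (b1 t) by apply: db; rewrite t0.
    have := is_derive_continuous d => /cvg_at_left_filter; apply: cvg_trans.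
    apply: near_eq_cvg; near=> x; rewrite BE//; near: x.
have [x xt E] := MVT t0 dB cB.
exists x; first by move: xt; rewrite in_itv.
by move: E; rewrite BE// /B lexx !subr0 mulrC.
Unshelve. all: end_near. Qed.

Let b_le (t : R) : 0 < t < T -> b t / t <= L.
Proof.
move=> /[dup] tT /b_MVT[x /andP[x0 xt] ->].
have /andP[t0 t1] := tT.
rewrite mulrC mulKf ?gt_eqF//; apply: le_trans (ler_norm _) _.
by apply: b1_bound; rewrite x0 (lt_trans xt).
Qed.

(* The derivative of b t / t. By the mean value theorem b t / t is b1 x with
   x < t, so this quantity is (b1 t - b1 x) / t, bounded by the bound on b2. *)
Let b_slope_derive (t : R) : 0 < t < T -> `|b1 t / t - b t / t ^+ 2| <= L.
Proof.
move=> /[dup] tT /b_MVT[x /andP[x0 xt] ->].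
have /andP[t0 t1] := tT.
have tN0 : t != 0 by rewrite gt_eqF.
have d (y : R) : y \in `]x, t[ -> is_derive y 1 b1 (b2 y).
  rewrite in_itv/= => /andP[xy yt]; apply: db1.
  by rewrite (lt_trans x0 xy) (lt_trans yt).
have c : {within `[x, t], continuous b1}.
  apply: continuous_in_subspaceT => y; rewrite inE/= in_itv/= => /andP[xy yt].
  apply: (@is_derive_continuous R b1 y (b2 y)); apply: db1.
  by rewrite (lt_le_trans x0 xy) (le_lt_trans yt).
have [y] := MVT xt d c; rewrite in_itv/= => /andP[xy yt] E.
have -> : b1 t / t - t * b1 x / t ^+ 2 = (b1 t - b1 x) / t by field.
rewrite E normrM normrM normfV (ger0_norm (ltW t0)) (@ger0_norm _ (t - x)); last first.
  by rewrite subr_ge0 ltW.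
rewrite ler_pdivrMr//; apply: ler_pM => //; first by rewrite subr_ge0 ltW.
  by apply: b2_bound; rewrite (lt_trans x0 xy) (lt_trans yt).
by rewrite gerBl ltW.
Qed.

(* The three factors of the kernel and their derivatives. *)
Let E (t : R) : R := expR (b t * ln t).
Let q (t : R) : R := b t / t.
Let V (t : R) : R := (Gamma (1 + b t))^-1.
Let dE (t : R) : R := E t * (b1 t * ln t + q t).
Let dq (t : R) : R := b1 t / t - b t / t ^+ 2.
Let dV (t : R) : R := - (Gamma (1 + b t)) ^- 2 * (dGamma (1 + b t) * b1 t).

(** The Abel kernel, rewritten by the functional equation of Gamma as a product
    of factors which have limits at 0; see [abel_kernelE]. *)
Definition regular_kernel t : R := E t * q t * V t.
Definition dregular_kernel t : R := (dE t * q t + E t * dq t) * V t + E t * q t * dV t.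

Lemma is_derive_regular_kernel (t : R) : 0 < t < T ->
  is_derive t 1 regular_kernel (dregular_kernel t).
Proof.
move=> /[dup] tT /andP[t0 t1].
have tN0 : t != 0 by rewrite gt_eqF.
have /andP[bt0 bt1] := b_01 tT.
have dbt := db tT.
have dl := is_derive1_ln t0.
have dEt : is_derive t 1 E (dE t).
  have d1 := is_deriveM dbt dl.
  have := @is_derive1_comp _ expR (b * @ln R) t _ _ (is_derive_expR _) d1.
  by move=> D; apply: (is_derive_eq D); rewrite /dE /E /q /GRing.scale/=; ring.
have dqt : is_derive t 1 q (dq t).
  have := is_deriveM dbt (is_deriveV tN0 (is_derive_id t 1)).
  by move=> D; apply: (is_derive_eq D); rewrite /dq /GRing.scale/=; field.
have dVt : is_derive t 1 V (dV t).
  have d1 : is_derive t 1 (fun t => 1 + b t) (b1 t).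
    by have := is_deriveD (is_derive_cst (1 : R) t 1) dbt; rewrite add0r.
  have G0 : 0 < Gamma (1 + b t) by apply: Gamma_gt0; lra.
  have d2 : is_derive (1 + b t) 1 Gamma (dGamma (1 + b t)).
    by apply: is_derive_Gamma; lra.
  have d3 := @is_derive1_comp _ Gamma (fun t => 1 + b t) t _ _ d2 d1.
  exact: (@is_deriveV R (fun t => Gamma (1 + b t)) t _ (lt0r_neq0 G0) d3).
have D := is_deriveM (is_deriveM dEt dqt) dVt.
apply: (is_derive_eq D); rewrite /dregular_kernel /GRing.scale/=.
rewrite fctE; ring.
Qed.

(* The argument 1 + b t stays in [1, 2], where Gamma is bounded away from 0 and
   its derivative is bounded. *)
Let Gamma_bounds : exists2 C : R, 0 < C &
  forall t : R, 0 < t < T -> `|V t| <= C /\ `|dV t| <= C * L.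
Proof.
have cG : {within `[1, 2], continuous (@Gamma R)}.
  apply: continuous_in_subspaceT => y; rewrite inE/= in_itv/= => /andP[y1 y2].
  by apply: (@is_derive_continuous R Gamma y (dGamma y)); apply: is_derive_Gamma; lra.
have cdG : {within `[1, 2], continuous (@dGamma R)}.
  apply: continuous_in_subspaceT => y; rewrite inE/= in_itv/= => /andP[y1 y2].
  by apply: dGamma_continuous; lra.
have le12 : (1 : R) <= 2 by lra.
have [x + hx] := EVT_min le12 cG.
have [y _ hy] := EVT_max le12 cdG.
have [z _ hz] := EVT_min le12 cdG.
rewrite in_itv/= => /andP[x1 x2].
have G0 : 0 < Gamma x by apply: Gamma_gt0; lra.
exists ((Gamma x)^-1 + (Gamma x)^-2 * (`|dGamma y| + `|dGamma z|)).
  by rewrite ltr_pwDl ?invr_gt0// mulr_ge0 ?addr_ge0// invr_ge0 exprn_ge0// ltW.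
move=> t /[dup] tT /b_01 bt.
have bI : 1 + b t \in `[1, 2] by rewrite in_itv/=; lra.
exact: (@inverse_bounds R (Gamma x) (Gamma (1 + b t)) (dGamma (1 + b t)) _ (b1 t) L
  G0 (hx _ bI) (norm_between (hz _ bI) (hy _ bI)) (b1_bound tT)).
Qed.

Let E_bound (t : R) : 0 < t < T -> 0 <= E t <= 1 + T.
Proof.
move=> /[dup] tT /andP[t0 t1]; have /andP[b0 b1'] := b_01 tT.
rewrite /E expR_ge0/=; case: (leP t 1) => ht.
  apply: (@le_trans _ _ 1); last by rewrite lerDl ltW.
  by rewrite expR_le1 mulr_ge0_le0 ?ln_le0// ltW.
apply: (@le_trans _ _ (expR (ln t))).
  by rewrite ler_expR ler_piMl ?ln_ge0// ltW.
by rewrite lnK ?posrE//; lra.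
Qed.

Let ln_bound (t : R) : 0 < t < T -> `|ln t| <= 2 * t `^ (- 2^-1) + T.
Proof.
move=> /andP[t0 t1]; case: (leP t 1) => ht.
  have h20 : (0 : R) < 2^-1 by rewrite invr_gt0.
  have := @ln_le_powRN R 2^-1 t h20; rewrite t0 ht invrK => /(_ isT) h.
  by rewrite (le_trans h)// lerDl ltW.
rewrite ger0_norm ?ln_ge0 ?(ltW ht)//.
apply: (@le_trans _ _ T); last by rewrite lerDr mulr_ge0 ?powR_ge0.
by apply: ltW; apply: lt_trans (ln_sublinear t0) t1.
Qed.

(** The only unbounded term comes from the derivative of [expR (b t * ln t)] and
    is of logarithmic size; the power [- 1/2] is a convenient integrable bound
    for it. *)
Lemma dregular_kernel_bound : exists2 C : R, 0 < C &
  forall t : R, 0 < t < T -> `|dregular_kernel t| <= C * (t `^ (- 2^-1) + 1).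
Proof.
have [C C0 hC] := Gamma_bounds.
pose M : R := (1 + T) * (L * (3 + T) * L + L + L * L) * C.
have T1 : 0 < 1 + T by rewrite addr_gt0.
exists M.
  by rewrite /M !mulr_gt0// !addr_gt0// !mulr_gt0// addr_gt0.
move=> t tT.
have /andP[E0 ET] := E_bound tT.
have [hV hdV] := hC _ tT.
have hdq := b_slope_derive tT.
have ht := ln_bound tT.
have p0 : 0 <= t `^ (- 2^-1) by exact: powR_ge0.
move: (t `^ (- 2^-1)) p0 ht => p p0 ht.
have hq : `|q t| <= L.
  rewrite ger0_norm; first exact: b_le.
  have /andP[t0 _] := tT; have /andP[bt0 _] := b_01 tT.
  by rewrite divr_ge0 ?ltW.
have hE : `|E t| <= 1 + T by rewrite ger0_norm.
have hdE : `|dE t| <= (1 + T) * (L * (2 * p + T) + L).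
  rewrite normrM ler_pM//; apply: (le_trans (ler_normD _ _)); rewrite lerD//.
  by rewrite normrM ler_pM// b1_bound.
apply: (@le_trans _ _ (((1 + T) * (L * (2 * p + T) + L) * L + (1 + T) * L) * C
    + (1 + T) * L * (C * L))).
  rewrite /dregular_kernel; apply: (le_trans (ler_normD _ _)); apply: lerD.
    rewrite normrM ler_pM//; apply: (le_trans (ler_normD _ _)); apply: lerD.
      by rewrite normrM ler_pM.
    by rewrite normrM ler_pM.
  by rewrite normrM ler_pM// normrM ler_pM.
rewrite -subr_ge0.
rewrite (_ : _ - _ = (1 + T) * C * (L * L * (p * (1 + T) + 2) + (L + L * L) * p)).
  by rewrite !mulr_ge0// ?addr_ge0// ?mulr_ge0// ?addr_ge0// ?mulr_ge0// ?ltW.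
rewrite /M; ring.
Qed.

Lemma dregular_kernel_continuous (t : R) : 0 < t < T ->
  {for t, continuous dregular_kernel}.
Proof.
move=> /[dup] tT /andP[t0 t1].
have tN0 : t != 0 by rewrite gt_eqF.
have /andP[bt0 bt1] := b_01 tT.
have cb : {for t, continuous b} := is_derive_continuous (db tT).
have cb1 : {for t, continuous b1} := is_derive_continuous (db1 tT).
have cid : {for t, continuous (fun x : R => x)} by exact: cvg_id.
have cln : {for t, continuous (@ln R)} by exact: continuous_ln.
have cE : {for t, continuous E}.
  apply: (@continuous_comp _ _ _ (fun t => b t * ln t) expR).
    exact: cvgM.
  exact: continuous_expR.
have cV1 : {for t, continuous (fun x : R => x^-1)} by exact: cvgV.
have cq : {for t, continuous q} by exact: cvgM.
have cdq : {for t, continuous dq}.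
  apply: cvgB; first exact: cvgM.
  apply: cvgM => //; apply: cvgV; first by rewrite expf_neq0.
  by apply: cvgM.
have c1b : {for t, continuous (fun x : R => 1 + b x)}.
  by apply: cvgD; [exact: cvg_cst|exact: cb].
have G0 : 0 < Gamma (1 + b t) by apply: Gamma_gt0; rewrite addr_gt0.
have p0 : 0 < 1 + b t by rewrite addr_gt0.
have cG : {for t, continuous (fun x => Gamma (1 + b x))}.
  apply: (@continuous_comp _ _ _ (fun x => 1 + b x) (@Gamma R)) => //.
  exact: is_derive_continuous (is_derive_Gamma p0).
have cdG : {for t, continuous (fun x => dGamma (1 + b x))}.
  apply: (@continuous_comp _ _ _ (fun x => 1 + b x) (@dGamma R)) => //.
  exact: dGamma_continuous.
have cV : {for t, continuous V} by apply: cvgV => //; exact: lt0r_neq0.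
have cdV : {for t, continuous dV}.
  apply: cvgM; last exact: cvgM.
  apply: cvgN; apply: cvgV; first by rewrite expf_neq0// gt_eqF.
  exact: cvgM.
have cdE : {for t, continuous dE}.
  by apply: cvgM => //; apply: cvgD => //; exact: cvgM.
apply: cvgD.
  by apply: cvgM => //; apply: cvgD; apply: cvgM.
by apply: cvgM => //; exact: cvgM.
Qed.

Lemma dregular_kernel_integrable :
  mu.-integrable `]0, T[ (EFin \o dregular_kernel).
Proof.
have mI : measurable (`]0, T[ : set R) by exact: measurable_itv.
have [C C0 hC] := dregular_kernel_bound.
have ip : mu.-integrable `]0, T[ (EFin \o (fun t : R => t `^ (- 2^-1))).
  have mI' : measurable (`]0, T] : set R) by exact: measurable_itv.
  have i2 : (-1 : R) < - 2^-1 by lra.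
  apply: (@integrableS _ _ _ mu _ _ _ mI' mI _ (integrable_powR i2 T_gt0)).
  exact: subset_itv_oo_oc.
have i1 : mu.-integrable `]0, T[ (EFin \o cst (1 : R)).
  apply: (@measurable_bounded_integrable _ _ _ mu _ _ mI) => //.
    by rewrite /= lebesgue_measure_itv/= lte_fin T_gt0 -EFinB ltry.
  exact: bounded_cst.
have iD := @integrableZl _ _ _ mu _ mI C _ (@integrableD _ _ _ mu _ mI _ _ ip i1).
apply: (@le_integrable _ _ _ mu _ mI _ _ _ _ iD).
  apply/measurable_EFinP; apply: open_continuous_measurable_fun.
    exact: interval_open.
  by move=> t; rewrite inE/= in_itv/=; exact: dregular_kernel_continuous.
move=> t; rewrite /= in_itv/= => tT.
rewrite lee_fin [leRHS]ger0_norm; first exact: hC.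
by rewrite mulr_ge0 ?(ltW C0)// addr_ge0// powR_ge0.
Qed.

Lemma regular_kernel_cvg0 : regular_kernel t @[t --> 0^'+] --> kappa0 / Gamma 1.
Proof.
have h20 : (0 : R) < 2^-1 by rewrite invr_gt0.
have Elim : E t @[t --> 0^'+] --> (1 : R).
  rewrite -expR0; apply: (@cvg_comp _ _ _ (fun t => b t * ln t) expR _ (nbhs 0)); last first.
    exact: continuous_expR.
  have tl : t * ln t @[t --> 0^'+] --> (0 : R).
    apply/norm_cvg0P; apply: (@squeeze_cvgr _ _ _ _ (cst 0) (fun t => 2 * t `^ 2^-1)).
    - near=> t.
      have t0 : 0 < t by near: t; exact: nbhs_right_gt.
      have t1 : t < 1 by near: t; exact: nbhs_right_lt.
      rewrite normr_ge0/= normrM (ger0_norm (ltW t0)).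
      have := @ln_le_powRN R 2^-1 t h20; rewrite t0 (ltW t1) invrK => /(_ isT) h.
      apply: (@le_trans _ _ (t * (2 * t `^ (- 2^-1)))); first by rewrite ler_wpM2l// ltW.
      rewrite mulrCA ler_wpM2l// -[X in X * _](powRr1 (ltW t0)) -powRD; last first.
        by rewrite (gt_eqF t0) implybT.
      have -> : 1 - 2^-1 = 2^-1 :> R by lra.
      exact: lexx.
    - exact: cvg_cst.
    - rewrite -[X in _ --> X](mulr0 2); apply: cvgM; first exact: cvg_cst.
      by apply: powR_cvg0; lra.
  have : b t / t * (t * ln t) @[t --> 0^'+] --> kappa0 * 0 by exact: cvgM.
  rewrite mulr0; apply: cvg_trans; apply: near_eq_cvg; apply: near0T => t /andP[t0 _].
  by rewrite mulrA divfK// gt_eqF.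
have Vlim : V t @[t --> 0^'+] --> (Gamma 1)^-1.
  have G1 : 0 < Gamma 1 :> R by exact: Gamma_gt0.
  have c1 : 1 + b t @[t --> 0^'+] --> (1 : R).
    rewrite -[X in _ --> X](addr0 (1 : R)).
    by apply: cvgD; [exact: cvg_cst|exact: b_cvg0].
  have c2 := @is_derive_continuous R Gamma 1 (dGamma 1) (is_derive_Gamma ltr01).
  have c3 : Gamma (1 + b t) @[t --> 0^'+] --> (Gamma 1 : R).
    exact: (@cvg_comp R R R (fun t => 1 + b t) (@Gamma R) _ _ _ c1 c2).
  by apply: cvgV c3; exact: lt0r_neq0.
rewrite -[kappa0]mul1r; apply: cvgM; last exact: Vlim.
exact: cvgM.
Unshelve. all: end_near. Qed.

(** The fundamental theorem of calculus on [`]0, x]], the limit at 0 being the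
    boundary term. *)
Lemma regular_kernel_integral (x : R) : 0 < x < T ->
  regular_kernel x = kappa0 / Gamma 1 + \int[mu]_(t in `]0, x[) dregular_kernel t.
Proof.
move=> /andP[x0 xT].
have mI : measurable (`]0, T[ : set R) by exact: measurable_itv.
have ic : mu.-integrable `]0, x] (EFin \o dregular_kernel).
  apply: (@integrableS _ _ _ mu _ _ _ mI _ _ dregular_kernel_integrable).
    exact: measurable_itv.
  by move=> y; rewrite /= !in_itv/= => /andP[-> yx]; exact: le_lt_trans xT.
have io : mu.-integrable `]0, x[ (EFin \o dregular_kernel).
  apply: (@integrableS _ _ _ mu _ _ _ _ _ _ ic); try exact: measurable_itv.
  exact: subset_itv_oo_oc.
rewrite Rintegral_itv_bndo_bndc// /Rintegral.
rewrite (@FTC_oc R dregular_kernel regular_kernel x _ x0 _ _ regular_kernel_cvg0 ic).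
- by rewrite /= addrC subrK.
- move=> y /andP[y0 yx]; apply: is_derive_regular_kernel.
  by rewrite y0 (le_lt_trans yx).
- move=> y /andP[y0 yx]; apply: dregular_kernel_continuous.
  by rewrite y0 (le_lt_trans yx).
Qed.

End AbelKernel.

Section KernelOfExponent.
Context {R : realType}.
Local Notation mu := (@lebesgue_measure R).
Implicit Types (T : R) (a : R -> R).

(** In the interior, the restriction of the increments to [`[0, T]] is
    harmless. *)
Lemma deriv_on_is_derive T a a1 (t : R) : 0 < t < T -> deriv_on T a a1 ->
  is_derive t 1 a (a1 t).
Proof.
move=> /andP[t0 tT] da.
have c : h^-1 *: ((a \o shift t) (h *: 1) - a t) @[h --> 0^'] --> a1 t.
  have tI : t \in `[0, T] by rewrite in_itv/= !ltW.
  have nT : \forall h \near (0 : R)^', t + h \in `[0, T].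
    pose e := Num.min t (T - t).
    have e0 : 0 < e by rewrite lt_min t0 subr_gt0.
    near=> h; have : `|h| < e by near: h; exact: (@dnbhs0_lt R R e e0).
    rewrite lt_min !ltr_norml in_itv/= => /andP[/andP[? _] /andP[_ ?]].
    by apply/andP; split; lra.
  move=> P /(da t tI) hP; have hP' : \forall h \near (0 : R)^',
    t + h \in `[0, T] -> P (h^-1 * (a (t + h) - a t)) by exact: hP.
  suff : \forall h \near (0 : R)^', P (h^-1 *: ((a \o shift t) (h *: 1) - a t)) by [].
  by apply: filterS2 nT hP' => h hT; rewrite /= /GRing.scale/= mulr1 [h + t]addrC; exact.
apply: DeriveDef; first by apply/cvg_ex; exists (a1 t).
exact: cvg_lim.
Unshelve. all: end_near. Qed.

Lemma deriv_on_slope0 T a a1 : 0 < T -> deriv_on T a a1 ->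
  (a h - a 0) / h @[h --> 0^'+] --> a1 0.
Proof.
move=> T0 da.
have I0 : 0 \in `[0, T] by rewrite in_itv/= lexx ltW.
move=> P /(da 0 I0) hP; have hP' : \forall h \near (0 : R),
  h != 0 -> 0 + h \in `[0, T] -> P (h^-1 * (a (0 + h) - a 0)) by exact: hP.
suff : \forall h \near (0 : R), 0 < h -> P ((a h - a 0) / h) by [].
near=> h => h0; have : h != 0 -> 0 + h \in `[0, T] -> P (h^-1 * (a (0 + h) - a 0)).
  by near: h; exact: hP'.
rewrite add0r mulrC gt_eqF// in_itv/= ltW//; apply=> //; apply/ltW.
by near: h; exact: lt_nbhsl.
Unshelve. all: end_near. Qed.

Lemma abel_kernelE a (t : R) : 0 < t -> a t < 1 ->
  abel_kernel a t = regular_kernel (fun s => 1 - a s) t.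
Proof.
move=> t0 at1; rewrite /abel_kernel /regular_kernel.
have b0 : 0 < 1 - a t by rewrite subr_gt0.
rewrite [1 + (1 - a t)]addrC (GammaS b0) /powR gt_eqF//.
have -> : - a t * ln t = (1 - a t) * ln t - ln t by ring.
rewrite expRB lnK ?posrE//.
have G0 : Gamma (1 - a t) != 0 by rewrite gt_eqF// Gamma_gt0.
have tN0 : t != 0 by rewrite gt_eqF.
have bN0 : 1 - a t != 0 by rewrite gt_eqF.
by field; rewrite G0 tN0 bN0.
Qed.

(** The estimates above apply to [b = 1 - a]. The limit [kappa] is nonnegative
    because [a < 1] on [`]0, T]], and it is not 0 because [a1 0] is not. *)
Lemma abel_kernel_regular T L a a1 a2 a3 : 0 < T -> 0 < L ->
  deriv_on T a a1 -> deriv_on T a1 a2 ->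
  (forall t, t \in `[0, T] -> `|a1 t| + `|a2 t| + `|a3 t| <= L) ->
  (forall t, t \in `]0, T] -> 0 < a t < 1) -> a 0 = 1 -> a1 0 != 0 ->
  exists kappa (h : R -> R), [/\ 0 < kappa, mu.-integrable `]0, T[ (EFin \o h) &
    forall x, 0 < x < T -> abel_kernel a x = kappa + \int[mu]_(t in `]0, x[) h t].
Proof.
move=> T0 L0 da da1 aL a01 a0 a1N0.
pose b t : R := 1 - a t; pose b1 t : R := - a1 t; pose b2 t : R := - a2 t.
have oc (t : R) : 0 < t < T -> t \in `]0, T] by rewrite in_itv/= => /andP[-> /ltW].
have cc (t : R) : 0 < t < T -> t \in `[0, T] by rewrite in_itv/= => /andP[/ltW -> /ltW].
have db (t : R) : 0 < t < T -> is_derive t 1 b (b1 t).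
  move=> /deriv_on_is_derive-/(_ _ _ da) d.
  by have D := is_deriveB (is_derive_cst (1 : R) t 1) d; apply: (is_derive_eq D); rewrite sub0r.
have db1 (t : R) : 0 < t < T -> is_derive t 1 b1 (b2 t).
  by move=> /deriv_on_is_derive-/(_ _ _ da1) d; exact: is_deriveN.
have b1L (t : R) : 0 < t < T -> `|b1 t| <= L.
  move=> /cc/aL; rewrite normrN; have := normr_ge0 (a2 t); have := normr_ge0 (a3 t).
  by move=> ? ? ?; lra.
have b2L (t : R) : 0 < t < T -> `|b2 t| <= L.
  move=> /cc/aL; rewrite normrN; have := normr_ge0 (a1 t); have := normr_ge0 (a3 t).
  by move=> ? ? ?; lra.
have b01 (t : R) : 0 < t < T -> 0 < b t < 1.
  by move=> /oc/a01 /andP[? ?]; rewrite /b; apply/andP; split; lra.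
have bs : b t / t @[t --> 0^'+] --> - a1 0.
  rewrite (_ : (fun t => b t / t) = (fun t => - ((a t - a 0) / t))).
    exact: (cvgN (deriv_on_slope0 T0 da)).
  by apply/funext => t; rewrite /b a0 -mulNr opprB.
have k0 : 0 < - a1 0.
  rewrite lt_neqAle eq_sym oppr_eq0 a1N0/=.
  rewrite -(cvg_lim (@Rhausdorff R) bs).
  apply: (@limr_ge R (0 : R)^'+ (at_right_proper_filter 0) R 0 _ (cvgP _ bs)).
  near=> t; have t0 : 0 < t by near: t; exact: nbhs_right_gt.
  have tT : t < T by near: t; exact: nbhs_right_lt.
  have /b01/andP[bt0 _] : 0 < t < T by rewrite t0.
  by rewrite divr_ge0// ltW.
exists (- a1 0 / Gamma 1), (dregular_kernel b b1).
have i := dregular_kernel_integrable T0 L0 db db1 b1L b2L b01 bs.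
split=> //; first by rewrite divr_gt0// Gamma_gt0.
move=> x /[dup] xT /andP[x0 _].
rewrite abel_kernelE//; last by have /oc/a01/andP[] := xT.
exact: (regular_kernel_integral T0 L0 db db1 b1L b2L b01 bs xT).
Unshelve. all: end_near. Qed.
End KernelOfExponent.

(** * Volterra convolutions *)

Section TranslationKernel.
Context {R : realType}.
Local Notation mu := (@lebesgue_measure R).

(** By Tonelli and invariance under translations, as in Young's inequality. The
    bounded factor [W] serves to truncate the outer
    variable. *)
Lemma integrable_translation_kernel (W H V : R -> R) :
  measurable_fun setT W -> (forall x : R, `|W x| <= 1) ->
  mu.-integrable setT (EFin \o H) -> mu.-integrable setT (EFin \o V) ->
  (mu \x mu)%E.-integrable setT
    (fun p : R * R => (W p.1 * (H (p.1 - p.2) * V p.2))%:E).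
Proof.
move=> mW W1 iH iV.
have mH : measurable_fun setT H by apply/measurable_EFinP; exact: measurable_int iH.
have mV : measurable_fun setT V by apply/measurable_EFinP; exact: measurable_int iV.
have mWp : measurable_fun setT (fun p : R * R => W p.1).
  by apply: measurableT_comp => //; exact: measurable_fst.
have mVp : measurable_fun setT (fun p : R * R => V p.2).
  by apply: measurableT_comp => //; exact: measurable_snd.
have mHp : measurable_fun setT (fun p : R * R => H (p.1 - p.2)).
  by apply: measurableT_comp => //; apply: measurable_funB; [exact: measurable_fst|exact: measurable_snd].
have mf : measurable_fun setT
    (fun p : R * R => (W p.1 * (H (p.1 - p.2) * V p.2))%:E).
  by apply/measurable_EFinP; apply: measurable_funM => //; exact: measurable_funM.
apply/(integrable21ltyP mu mu mf).
have mnH : measurable_fun setT (fun x : R => `|H x|%:E).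
  by apply/measurable_EFinP; exact: measurableT_comp.
have mnV : measurable_fun setT (fun x : R => `|V x|%:E).
  by apply/measurable_EFinP; exact: measurableT_comp.
have msub (y : R) : measurable_fun setT (fun x : R => x - y).
  by apply: measurable_funB; [exact: measurable_id|exact: measurable_cst].
have mS (y : R) : measurable_fun setT (fun x : R => (`|V y|%:E * `|H (x - y)|%:E)%E).
  apply: emeasurable_funM; first exact: measurable_cst; apply/measurable_EFinP.
  by apply: measurableT_comp => //; apply: measurableT_comp => //; exact: msub.
have mfs (y : R) : measurable_fun setT
    (fun x : R => `|(W x * (H (x - y) * V y))%:E|%E).
  apply: measurableT_comp => //; apply/measurable_EFinP; apply: measurable_funM => //.
  apply: measurable_funM; last exact: measurable_cst.
  by apply: measurableT_comp => //; exact: msub.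
apply: (@le_lt_trans _ _ (\int[mu]_y (`|V y|%:E * \int[mu]_x `|H x|%:E)))%E.
  apply: ge0_le_integral => //.
  - by move=> y _; exact: integral_ge0.
  - apply: (@measurable_fun_fubini_tonelli_G _ _ _ _ R mu
        (fun p : R * R => `|(W p.1 * (H (p.1 - p.2) * V p.2))%:E|%E)) => //.
    exact: measurableT_comp.
  - by apply: emeasurable_funM => //; exact: measurable_cst.
  - move=> y _; rewrite -(@integral_shift R (fun x => `|H x|%:E) y mnH) -ge0_integralZl//; last first.
      apply/measurable_EFinP; apply: measurableT_comp => //; apply: measurableT_comp => //.
      exact: msub.
    apply: ge0_le_integral => //.
    + exact: (mfs y).
    + exact: (mS y).
    + move=> x _; rewrite -EFinM lee_fin !normrM mulrC [leRHS]mulrC.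
      by rewrite -[leRHS]mulr1 ler_pM// mulrC.
rewrite ge0_integralZr//; last exact: integral_ge0.
apply: lte_mul_pinfty; first exact: integral_ge0.
  apply/fin_numP; split; last first.
    by have /integrableP[_] := iV; rewrite lt_neqAle => /andP[].
  by rewrite gt_eqF// (@lt_le_trans _ _ 0%E)// integral_ge0.
by have /integrableP[_] := iH.
Qed.

End TranslationKernel.

Lemma restrict_itvE {R : realType} (g : R -> R) (x y z : R) :
  (g \_ `]x, y[) z = if x < z < y then g z else 0.
Proof. by rewrite patchE mem_setE in_itv. Qed.

Section Volterra.
Context {R : realType}.
Local Notation mu := (@lebesgue_measure R).
Implicit Types (T t : R) (g h v : R -> R).

(** The causal convolution of [h] and [v]. *)
Definition volterra h v t : R := \int[mu]_(s in `]0, t[) (h (t - s) * v s).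

Lemma integrable_restrict T g : L1 T g -> mu.-integrable setT (EFin \o g \_ `]0, T[).
Proof.
move=> ig; rewrite -restrict_EFin; apply/(integrable_mkcond _ _).1 => //.
Qed.

(** For [t <= T], extending both functions by 0 outside of [`]0, T[] turns the
    causal convolution into a convolution over the whole line. *)
Lemma volterra_restrict T h v t : 0 < t <= T ->
  (fun s => h (t - s) * v s) \_ `]0, t[ =
  (fun s => (h \_ `]0, T[) (t - s) * (v \_ `]0, T[) s).
Proof.
move=> /andP[t0 tT]; apply/funext => s; rewrite !restrict_itvE.
case: (ltP 0 s) => s0 /=; last by rewrite mulr0.
case: (ltP s t) => st.
  have h1 : t - s < T by lra.
  have h2 : s < T by lra.
  by rewrite subr_gt0 st h1 h2.
by rewrite subr_gt0 ltNge st/= mul0r.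
Qed.

Lemma volterraE T h v t : 0 < t <= T ->
  volterra h v t = \int[mu]_s ((h \_ `]0, T[) (t - s) * (v \_ `]0, T[) s).
Proof.
by move=> tT; rewrite /volterra Rintegral_mkcond (volterra_restrict _ _ tT).
Qed.

Let convolution_integrable T h v : L1 T h -> L1 T v ->
  (mu \x mu)%E.-integrable setT
    (fun p : R * R => (1 * ((h \_ `]0, T[) (p.1 - p.2) * (v \_ `]0, T[) p.2))%:E).
Proof.
move=> /integrable_restrict ih /integrable_restrict iv.
apply: (@integrable_translation_kernel R (cst 1)) => //.
by move=> x; rewrite normr1.
Qed.

(** By Fubini, applied to the functions extended by 0. *)
Lemma volterra_section_integrable T h v : L1 T h -> L1 T v ->
  ae_on T (fun t => mu.-integrable `]0, t[ (EFin \o (fun s => h (t - s) * v s))).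
Proof.
move=> ih iv; have := ae_integrable1 (convolution_integrable ih iv).
apply: filterS => t it tT; have tT' : 0 < t <= T.
  by move: tT; rewrite in_itv/= => /andP[-> /ltW].
apply/(integrable_mkcond _ _).2; first exact: measurable_itv.
rewrite restrict_EFin (volterra_restrict _ _ tT').
by move: it; rewrite /=; under eq_fun do rewrite mul1r.
Qed.

Lemma volterra_integrable T h v : L1 T h -> L1 T v -> L1 T (volterra h v).
Proof.
move=> ih iv; have iF := integrable_fubini_F (convolution_integrable ih iv).
set F := fubini_F _ _ in iF.
have mI : measurable (`]0, T[ : set R) by exact: measurable_itv.
have mF : measurable_fun setT F := measurable_int _ iF.
have i1 : mu.-integrable `]0, T[ (EFin \o (fun t => fine (F t))).
  have iFT : mu.-integrable `]0, T[ F by apply: integrableS iF.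
  apply: (@le_integrable _ _ _ mu _ mI _ _ _ _ iFT).
    apply/measurable_EFinP; apply: measurable_funTS.
    by apply: measurableT_comp => //; exact: measurable_fine.
  by move=> t _ /=; case: (F t) => //= *; rewrite ?normr0 ?leey.
apply: eq_integrable i1 => // t; rewrite inE/= in_itv/= => /andP[t0 tT].
rewrite (@volterraE T) ?t0 ?ltW// /F /fubini_F /Rintegral/=.
by under eq_integral do rewrite mul1r.
Qed.

End Volterra.

Section Primitive.
Context {R : realType}.
Local Notation mu := (@lebesgue_measure R).
Implicit Types (T t : R) (g h v k : R -> R).

(* The section at fixed s of the kernel which is used to integrate the
   convolution over ]0, t[. *)
Let primitive_section T h v t s : L1 T h -> 0 < t <= T ->
  (\int[mu]_x ((\1_(`]0, t[ : set R) x * ((h \_ `]0, T[) (x - s) * (v \_ `]0, T[) s))%:E))%E =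
  (((fun s => (\int[mu]_(x in `]0, (t - s)%R[) h x) * v s) \_ `]0, t[) s)%:E
  :> \bar R.
Proof.
move=> ih /andP[t0 tT]; rewrite [in RHS]restrict_itvE.
have indE (x : R) : \1_(`]0, t[ : set R) x = (0 < x < t)%R%:R :> R.
  by rewrite indicE mem_setE in_itv.
have [/andP[s0 st]|sN] := boolP (0 < s < t); last first.
  rewrite integral0_eq// => x _; rewrite indE !restrict_itvE.
  have [/andP[s0 sT]|_] := boolP (0 < s < T); last by rewrite !mulr0.
  rewrite s0 -leNgt /= in sN.
  have [/andP[x0 xt]|_] := boolP (0 < x < t); last by rewrite mul0r.
  by rewrite subr_gt0 ltNge (ltW (lt_le_trans xt sN))/= !(mul0r, mulr0).
have mI : measurable (`]0, t - s[ : set R) by exact: measurable_itv.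
have ih' : mu.-integrable setT (EFin \o h \_ `]0, t - s[).
  rewrite -restrict_EFin; apply/(integrable_mkcond _ _).1 => //.
  apply: (@integrableS _ _ _ mu _ _ _ _ mI _ ih); first exact: measurable_itv.
  by move=> x; rewrite /= !in_itv/= => /andP[-> ?]; rewrite /=; lra.
have mh : measurable_fun setT (h \_ `]0, t - s[).
  by apply/measurable_EFinP; exact: measurable_int ih'.
rewrite Rintegral_mkcond -RintegralZr// -[in RHS]/(EFin _) fineK; last first.
  apply: integrable_fin_num => //.
  exact: (@integrableZr _ _ _ mu _ measurableT (v s) _ ih').
have mF : measurable_fun setT (fun x : R => ((h \_ `]0, t - s[) x * v s)%:E).
  by apply/measurable_EFinP; apply: measurable_funM => //; exact: measurable_cst.
rewrite -[RHS](integral_shift s mF); apply: eq_integral => x _; congr EFin.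
rewrite indE !restrict_itvE mulrA s0 (lt_le_trans st tT)/=; congr (_ * _).
rewrite subr_gt0 ltrD2r.
have [sx|_] := boolP (s < x); last by rewrite mulr0.
have -> : 0 < x by lra.
have [xt|_] := boolP (x < t); last by rewrite mul0r.
have -> : x - s < T by lra.
by rewrite /= mul1r.
Qed.

(** Exchanging the integrals over the triangle [0 < s < r < t]: convolution
    commutes with taking primitives. *)
Lemma volterra_primitive T h v t : L1 T h -> L1 T v -> 0 < t <= T ->
  mu.-integrable `]0, t[
    (EFin \o (fun s => (\int[mu]_(x in `]0, (t - s)%R[) h x) * v s)) /\
  \int[mu]_(s in `]0, t[) volterra h v s =
  \int[mu]_(s in `]0, t[) ((\int[mu]_(x in `]0, (t - s)%R[) h x) * v s).
Proof.
move=> ih iv /[dup] tT /andP[t0 tT'].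
have mI : measurable (`]0, t[ : set R) by exact: measurable_itv.
have mW : measurable_fun setT (\1_(`]0, t[ : set R) : R -> R) by exact: measurable_indic.
have W1 (x : R) : `|\1_(`]0, t[ : set R) x : R| <= 1.
  by rewrite indicE; case: (_ \in _); rewrite ?normr1 ?normr0.
have iK := integrable_translation_kernel mW W1
  (integrable_restrict ih) (integrable_restrict iv).
have mK := measurable_int _ iK.
have mG := measurable_fubini_G iK.
have iG : mu.-integrable setT (EFin \o
   ((fun s => (\int[mu]_(x in `]0, (t - s)%R[) h x) * v s) \_ `]0, t[)).
  rewrite (_ : EFin \o _ = fubini_G mu (fun p : R * R =>
    (\1_(`]0, t[ : set R) p.1 * ((h \_ `]0, T[) (p.1 - p.2) * (v \_ `]0, T[) p.2))%:E)).
    apply/integrableP; split => //.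
    have := (integrable21ltyP mu mu mK).1 iK; apply: le_lt_trans.
    apply: ge0_le_integral => //.
    - exact: measurableT_comp.
    - apply: (@measurable_fun_fubini_tonelli_G _ _ _ _ R mu (fun p : R * R => `|
    (\1_(`]0, t[ : set R) p.1 * ((h \_ `]0, T[) (p.1 - p.2) * (v \_ `]0, T[) p.2))%:E|%E)) => //.
      exact: measurableT_comp.
    - move=> s _; apply: le_abse_integral => //.
      exact: (measurableT_comp mK (measurable_pair2 s)).
  by apply/funext => s; rewrite /fubini_G/= (primitive_section v s ih tT).
split.
  by apply/(integrable_mkcond _ _).2 => //; rewrite restrict_EFin.
rewrite [in RHS]Rintegral_mkcond /Rintegral.
under [in RHS]eq_integral do rewrite -(primitive_section v _ ih tT).
rewrite -(Fubini iK) [in LHS]integral_mkcond.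
have ivol : mu.-integrable `]0, t[ (EFin \o volterra h v).
  apply: (@integrableS _ _ _ mu _ _ _ _ mI _ (volterra_integrable ih iv)).
    exact: measurable_itv.
  by move=> x; rewrite /= !in_itv/= => /andP[-> ?]; rewrite /=; lra.
congr fine; apply: ae_eq_integral => //.
- by apply/(measurable_restrictT _ _).1 => //; exact: measurable_int ivol.
- exact: measurable_fubini_F iK.
have := ae_integrable1 iK; apply: filterS => x ix _.
rewrite restrict_EFin/= restrict_itvE indicE mem_setE in_itv/=.
move: ix; rewrite /= indicE mem_setE in_itv/=.
have [/andP[x0 xt]|_] := boolP (0 < x < t) => /= ix; last first.
  by rewrite integral0_eq// => y _; rewrite mul0r.
rewrite (@volterraE _ T); last by rewrite x0 ltW// (lt_le_trans xt).
under [in RHS]eq_integral do rewrite mul1r.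
rewrite /Rintegral fineK//; apply: integrable_fin_num => //.
by apply: eq_integrable ix => // y _; rewrite mul1r.
Qed.

End Primitive.

Section AbelVolterra.
Context {R : realType}.
Local Notation mu := (@lebesgue_measure R).
Implicit Types (T t : R) (g h v k : R -> R).

Lemma L1_subitv T t g : L1 T g -> t <= T -> mu.-integrable `]0, t[ (EFin \o g).
Proof.
move=> ig tT; apply: (@integrableS _ _ _ mu _ _ _ _ _ _ ig); try exact: measurable_itv.
by move=> x; rewrite /= !in_itv/= => /andP[-> ?]; rewrite /=; lra.
Qed.

(** The primitive part of the kernel contributes the primitive of the
    convolution with [h], by [volterra_primitive]. *)
Lemma abel_conv_volterra T kappa h k v t : L1 T h -> L1 T v ->
  (forall x, 0 < x < T -> k x = kappa + \int[mu]_(s in `]0, x[) h s) ->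
  t \in `[0, T] ->
  abel_conv k v t = (\int[mu]_(s in `]0, t[) (kappa * v s + volterra h v s))%:E.
Proof.
move=> ih iv kE; rewrite in_itv/= => /andP[t0 tT].
have [t00|tN0] := eqVneq t 0.
  by rewrite /abel_conv t00 set_itv_ge ?bnd_simp ?ltxx// integral_set0 Rintegral_set0.
have {t0}t0 : 0 < t by rewrite lt_neqAle eq_sym tN0.
have mI : measurable (`]0, t[ : set R) by exact: measurable_itv.
have tT' : 0 < t <= T by rewrite t0.
have [iP eP] := volterra_primitive ih iv tT'.
have iv' : mu.-integrable `]0, t[ (EFin \o v) by exact: L1_subitv tT.
have ikv : mu.-integrable `]0, t[ (EFin \o (fun s => kappa * v s)).
  exact: (@integrableZl _ _ _ mu _ mI kappa _ iv').
have iw : mu.-integrable `]0, t[ (EFin \o volterra h v).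
  exact: L1_subitv (volterra_integrable ih iv) tT.
rewrite (@RintegralD _ _ _ mu _ _ _ mI ikv iw) eP -(@RintegralD _ _ _ mu _ _ _ mI ikv iP).
rewrite /Rintegral fineK; last first.
  by apply: integrable_fin_num => //; exact: (@integrableD _ _ _ mu _ mI _ _ ikv iP).
apply: eq_integral => s; rewrite inE/= in_itv/= => /andP[s0 st].
rewrite kE ?mulrDl//; apply/andP; split; lra.
Qed.

(** Lebesgue differentiation, applied to the extensions by 0 of [g1] and
    [g2]. *)
Lemma ae_eq_of_primitive T g1 g2 : L1 T g1 -> L1 T g2 ->
  (forall t, t \in `]0, T[ ->
    \int[mu]_(s in `]0, t[) g1 s = \int[mu]_(s in `]0, t[) g2 s) ->
  ae_on T (fun t => g1 t = g2 t).
Proof.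
move=> i1 i2 e12.
have mI : measurable (`]0, T[ : set R) by exact: measurable_itv.
pose P g (x : R) : R := \int[mu]_(t in `]-oo, x]) (g \_ `]0, T[) t.
have F g : L1 T g -> {ae mu, forall x : R,
    derivable (P g) x 1 /\ derive1 (P g) x = (g \_ `]0, T[) x}.
  move=> ig; apply: FTC1Ny; last exact: integrable_locally.
  move=> y; apply: integrableS (integrable_restrict ig) => //.
have E g t : t \in `]0, T[ -> L1 T g -> P g t = \int[mu]_(s in `]0, t[) g s.
  rewrite in_itv/= => /andP[t0 tT] ig.
  rewrite /P [RHS]Rintegral_itv_bndo_bndc; last by exact: L1_subitv (ltW tT).
  rewrite Rintegral_mkcond [RHS]Rintegral_mkcond; congr Rintegral.
  apply/funext => s; rewrite !patchE !mem_setE !in_itv/=.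
  have [st|_] := leP s t; last by rewrite andbF.
  by rewrite (le_lt_trans st tT) andbT.
apply: (@filterS2 _ _ (ae_filter_ringOfSetsType mu) _ _ _ _ (F _ i2) (F _ i1)).
move=> t [_ d2] [_ d1] tT.
have tT' : 0 < t < T by move: tT; rewrite in_itv.
move: d2 d1; rewrite !restrict_itvE tT' => <- <-.
rewrite !derive1E; apply: near_eq_derive.
have /andP[t0 t1] := tT'.
near=> s; have sT : s \in `]0, T[.
  rewrite in_itv/=; apply/andP; split; near: s; [exact: lt_nbhsr|exact: lt_nbhsl].
by rewrite !E//; exact: e12.
Unshelve. all: end_near. Qed.

End AbelVolterra.

(** * The Volterra equation of the second kind *)

(** Dominated convergence as [c] tends to infinity along the integers. *)
Lemma small_exponential_weight {R : realType} (T : R) (h : R -> R) (e : R) :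
  L1 T h -> 0 < e -> exists2 c : R, 0 <= c &
  (\int[@lebesgue_measure R]_(x in `]0%R, T[) `|expR (- c * x) * h x|%:E <= e%:E)%E.
Proof.
set mu := @lebesgue_measure R => ih e0.
have mI : measurable (`]0, T[ : set R) by exact: measurable_itv.
have mh : measurable_fun (`]0, T[ : set R) h by apply/measurable_EFinP; exact: measurable_int ih.
pose F (n : nat) (x : R) : \bar R := `|expR (- n%:R * x) * h x|%:E.
have mF n : measurable_fun (`]0, T[ : set R) (F n).
  apply/measurable_EFinP; apply: measurableT_comp => //; apply: measurable_funM => //.
  apply: measurableT_comp => //; apply: measurable_funM => //; exact: measurable_cst.
have inh : mu.-integrable `]0, T[ (fun x : R => `|h x|%:E).
  exact: (@integrable_norm _ _ _ mu _ _ ih).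
have F0 (x : R) : `]0, T[%classic x -> F n x @[n --> \oo] --> 0%E.
  rewrite /= in_itv/= => /andP[x0 xT].
  have xe : `|expR (- x)| < 1 by rewrite ger0_norm ?expR_ge0// expR_lt1 oppr_lt0.
  have c : `|expR (- x) ^+ n * h x| @[n --> \oo] --> 0.
    by rewrite -(normr0 R) -(mul0r (h x)); apply: cvg_norm; apply: cvgMr_tmp; exact: cvg_expr.
  rewrite (_ : (fun n => F n x) = (fun n => (`|expR (- x) ^+ n * h x|)%:E)).
    by apply: cvg_EFin; [exact: nearW|exact: c].
  by apply/funext => n; rewrite /F mulNr -mulrN expRM_natl.
have Fle (n : nat) (x : R) : `]0, T[%classic x -> (`|F n x| <= `|h x|%:E)%E.
  rewrite /= in_itv/= => /andP[x0 xT]; rewrite normr_id lee_fin normrM.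
  by rewrite ler_piMl// ger0_norm ?expR_ge0// expR_le1 mulNr oppr_le0 mulr_ge0// ltW.
have c := @dominated_cvg _ _ _ mu _ mI F (cst 0%E) (fun x => `|h x|%:E) mF F0
  (fun _ _ => isT) inh Fle.
rewrite integral0 in c.
have [n _ hn] := c _ (@nbhs_open_ereal_lt R 0 (fun=> e) e0).
exists n%:R; first exact: ler0n.
by apply/ltW; apply: (hn n); exact: leqnn.
Qed.

Section Resolvent.
Context {R : realType}.
Local Notation mu := (@lebesgue_measure R).
Context (T kappa c : R) (h : R -> R).
Hypothesis kappa_gt0 : 0 < kappa.
Hypothesis c_ge0 : 0 <= c.
Hypothesis ih : L1 T h.
Hypothesis weight_small :
  (\int[mu]_(x in `]0%R, T[) `|expR (- c * x) * h x|%:E <= (kappa / 2)%:E)%E.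

Let mI : measurable (`]0, T[ : set R).
Proof. exact: measurable_itv. Qed.

Let mexp (a : R) : measurable_fun setT (fun x : R => expR (a * x)).
Proof.
by apply: measurableT_comp => //; apply: measurable_funM => //; exact: measurable_cst.
Qed.

(* The kernel of the equation satisfied by expR (- c * t) * u t. Restricting the
   second variable to ]0, T[ is enough: the support of H then forces s < t when
   t is in ]0, T[. *)
Let weighted (x : R) : R := expR (- c * x) * h x / kappa.
Let H : R -> R := weighted \_ `]0, T[.
Let K (p : R * R) : R := H (p.1 - p.2) * \1_(`]0, T[ : set R) p.2.

Let mH : measurable_fun setT H.
Proof.
apply/(measurable_restrictT _ _).1 => //; apply: measurable_funM; last exact: measurable_cst.
apply: measurable_funM; first exact: measurable_funTS (mexp _).
by apply/measurable_EFinP; exact: measurable_int ih.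
Qed.

Let mHn : measurable_fun setT (fun x : R => `|H x|%:E).
Proof. by apply/measurable_EFinP; exact: measurableT_comp. Qed.

Let H_half : (\int[mu]_x `|H x|%:E <= (2^-1)%:E)%E.
Proof.
have mw : measurable_fun (`]0, T[ : set R) (fun x : R => `|expR (- c * x) * h x|%:E).
  apply/measurable_EFinP; apply: measurableT_comp => //; apply: measurable_funM.
    exact: measurable_funTS (mexp _).
  by apply/measurable_EFinP; exact: measurable_int ih.
have -> : (\int[mu]_x `|H x|%:E =
    (kappa^-1)%:E * \int[mu]_(x in `]0%R, T[) `|expR (- c * x) * h x|%:E)%E.
  rewrite -ge0_integralZl//; last by rewrite lee_fin invr_ge0 ltW.
  rewrite [RHS]integral_mkcond; apply: eq_integral => x _.
  rewrite patchE /H restrict_itvE mem_setE in_itv/=.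
  case: ifP => _; last by rewrite normr0.
  by rewrite /weighted normrM normfV (gtr0_norm kappa_gt0) mulrC EFinM.
apply: (@le_trans _ _ ((kappa^-1)%:E * (kappa / 2)%:E)%E).
  by rewrite lee_wpmul2l// lee_fin invr_ge0 ltW.
by rewrite -EFinM lee_fin mulKf ?gt_eqF.
Qed.

Let mK : measurable_fun setT K.
Proof.
apply: measurable_funM.
  apply: measurableT_comp => //.
  by apply: measurable_funB; [exact: measurable_fst|exact: measurable_snd].
apply: (measurableT_comp (g := @snd R R)); last exact: measurable_snd.
exact: measurable_indic.
Qed.

Let K_le (t s : R) : (`|K (t, s)|%:E <= `|H (t - s)|%:E)%E.
Proof.
rewrite lee_fin /K normrM indicE /=.
by case: (_ \in _); rewrite ?normr1 ?normr0 ?mulr1 ?mulr0.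
Qed.

Let mKn : measurable_fun setT (fun p : R * R => `|K p|%:E).
Proof. by apply/measurable_EFinP; exact: measurableT_comp. Qed.

Let K1 (s : R) : (\int[mu]_t `|K (t, s)|%:E <= (2^-1)%:E)%E.
Proof.
apply: le_trans H_half; rewrite -(integral_shift s mHn); apply: ge0_le_integral => //.
- exact: (measurableT_comp mKn (measurable_pair2 s)).
- apply: (measurableT_comp mHn).
  by apply: measurable_funB; [exact: measurable_id|exact: measurable_cst].
Qed.

Let K2 (t : R) : (\int[mu]_s `|K (t, s)|%:E <= (2^-1)%:E)%E.
Proof.
apply: le_trans H_half; rewrite -(integral_reflect t mHn); apply: ge0_le_integral => //.
- exact: (measurableT_comp mKn (measurable_pair1 t)).
- apply: (measurableT_comp mHn).
  by apply: measurable_funB; [exact: measurable_cst|exact: measurable_id].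
Qed.

(* The weights recombine as expR (- c * (t - s)) = expR (- c * t) * expR (c * s). *)
Let K_volterra (w : R -> R) (t : R) : 0 < t < T ->
  (fun s => K (t, s) * w s) =
  (fun s => expR (- c * t) / kappa *
    ((fun s => h (t - s) * (expR (c * s) * w s)) \_ `]0, t[) s).
Proof.
move=> /andP[t0 tT]; apply/funext => s.
rewrite /K /H/= !restrict_itvE indicE mem_setE in_itv/= subr_gt0.
have [s0|s0] := ltP 0 s; last by rewrite /= !(mulr0, mul0r).
have [st|st] := ltP s t; last by rewrite /= !(mulr0, mul0r).
have -> : t - s < T by lra.
have -> : s < T by lra.
rewrite /= mulr1 /weighted (_ : - c * (t - s) = - c * t + c * s); last by ring.
by rewrite expRD; ring.
Qed.

Let Rintegral_K (w : R -> R) (t : R) : 0 < t < T ->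
  mu.-integrable `]0, t[ (EFin \o (fun s => h (t - s) * (expR (c * s) * w s))) ->
  \int[mu]_s (K (t, s) * w s) =
  expR (- c * t) / kappa * volterra h (fun s => expR (c * s) * w s) t.
Proof.
move=> tT it; rewrite (K_volterra w tT) RintegralZl//; first by rewrite /volterra -Rintegral_mkcond.
by rewrite -restrict_EFin; apply/(integrable_mkcond _ _).1 => //; exact: measurable_itv.
Qed.

Let expc_bounds (x : R) : 0 < x < T -> expR (- c * x) <= 1 /\ expR (c * x) <= expR (c * T).
Proof.
move=> /andP[x0 xT]; split.
  by rewrite expR_le1 mulNr oppr_le0 mulr_ge0// ltW.
by rewrite ler_expR ler_wpM2l// ltW.
Qed.

Let integrable_weight (a : R) (M : R) (g : R -> R) : L1 T g ->
  (forall x : R, 0 < x < T -> expR (a * x) <= M) -> L1 T (fun x => expR (a * x) * g x).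
Proof.
move=> ig aM; rewrite /L1.
have iM := @integrableZl _ _ _ mu _ mI M _ ig.
apply: (@le_integrable _ _ _ mu _ mI _ _ _ _ iM).
  apply/measurable_EFinP; apply: measurable_funM.
    exact: measurable_funTS (mexp _).
  by apply/measurable_EFinP; exact: measurable_int ig.
move=> x; rewrite /= in_itv/= => /aM aMx.
have M0 : 0 <= M by apply: le_trans aMx; exact: expR_ge0.
by rewrite lee_fin !normrM ler_wpM2r// !ger0_norm ?expR_ge0.
Qed.

(** The equation is solved for [w t = expR (- c * t) * u t] with the resolvent of
    the small kernel; going back to [u] costs a factor [expR (c * T)]. *)
Lemma volterra_resolvent g : L1 T g -> exists u : R -> R,
  [/\ L1 T u,
      ae_on T (fun t => kappa * u t + volterra h u t = g t),
      (L1norm T u <= (2 * expR (c * T) / kappa)%:E * L1norm T g)%E &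
      forall M, 0 <= M -> ae_on T (fun t => `|g t| <= M) ->
        ae_on T (fun t => `|u t| <= 2 * expR (c * T) / kappa * M)].
Proof.
move=> ig.
pose g1 : R -> R := (fun t => kappa^-1 * (expR (- c * t) * g t)) \_ `]0, T[.
have ig1 : mu.-integrable setT (EFin \o g1).
  have ig0 : L1 T (fun t => expR (- c * t) * g t).
    by apply: (@integrable_weight _ 1) => // x /expc_bounds[].
  exact: (integrable_restrict (@integrableZl _ _ _ mu _ mI kappa^-1 _ ig0)).
have [w [iw eqw w1 woo]] := @Schur_resolvent _ _ R mu K mK K1 K2 g1 ig1.
pose u (t : R) : R := expR (c * t) * w t.
have iwT : L1 T w by apply: integrableS iw.
have iu : L1 T u.
  by apply: (@integrable_weight _ (expR (c * T))) => // x /expc_bounds[].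
exists u; split => //.
- apply: (@filterS2 _ _ (ae_filter_ringOfSetsType mu) _ _ _ _ eqw
    (volterra_section_integrable ih iu)).
  move=> t eqt it tI; have tT : 0 < t < T by move: tI; rewrite in_itv.
  rewrite {1}/u eqt (Rintegral_K tT (it tI)) /g1 restrict_itvE tT mulNr expRN.
  rewrite -/u; have e0 : expR (c * t) != 0 by rewrite gt_eqF// expR_gt0.
  by field; rewrite e0 gt_eqF.
- apply: (@le_trans _ _ ((expR (c * T))%:E * \int[mu]_t `|w t|%:E))%E.
    have mwn : measurable_fun setT (fun x : R => `|w x|%:E).
      apply/measurable_EFinP; apply: measurableT_comp => //.
      by apply/measurable_EFinP; exact: measurable_int iw.
    rewrite -(@ge0_integralZl _ _ R mu _ measurableT _ mwn)//.
    apply: (@le_trans _ _ (\int[mu]_(t in `]0%R, T[) ((expR (c * T))%:E * `|w t|%:E))%E).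
      apply: ge0_le_integral => //.
      + apply/measurable_EFinP; apply: measurableT_comp => //.
        by apply/measurable_EFinP; exact: measurable_int iu.
      + by apply: measurable_funTS; apply: emeasurable_funM => //; exact: measurable_cst.
      + move=> x; rewrite /= in_itv/= => /expc_bounds[_ ex].
        by rewrite -EFinM lee_fin normrM ler_wpM2r// ger0_norm ?expR_ge0.
    apply: ge0_subset_integral => //.
    by apply: emeasurable_funM => //; exact: measurable_cst.
  have hg : (\int[mu]_t `|g1 t|%:E <= (kappa^-1)%:E * L1norm T g)%E.
    have mgn : measurable_fun (`]0, T[ : set R) (fun x : R => `|g x|%:E).
      apply/measurable_EFinP; apply: measurableT_comp => //.
      by apply/measurable_EFinP; exact: measurable_int ig.
    rewrite /L1norm -(@ge0_integralZl _ _ R mu _ mI _ mgn)//; last first.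
      by rewrite lee_fin invr_ge0 ltW.
    rewrite [leRHS]integral_mkcond; apply: ge0_le_integral => //.
    + apply/measurable_EFinP; apply: measurableT_comp => //.
      by apply/measurable_EFinP; exact: measurable_int ig1.
    + apply/(measurable_restrictT _ _).1 => //.
      by apply: emeasurable_funM => //; exact: measurable_cst.
    + move=> x _; rewrite patchE mem_setE in_itv/= /g1 restrict_itvE.
      have [/expc_bounds[ex _]|_] := boolP (0 < x < T); last by rewrite normr0.
      rewrite -EFinM lee_fin normrM ger0_norm ?invr_ge0 ?(ltW kappa_gt0)//.
      rewrite ler_wpM2l ?invr_ge0 ?(ltW kappa_gt0)// normrM ler_piMl//.
      by rewrite ger0_norm ?expR_ge0.
  rewrite (_ : (2 * expR (c * T) / kappa)%:E = (expR (c * T))%:E * (2%:E * (kappa^-1)%:E))%E; last first.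
    by rewrite -!EFinM; congr EFin; ring.
  rewrite -!muleA lee_wpmul2l ?lee_fin ?expR_ge0//; apply: (le_trans w1).
  by rewrite lee_wpmul2l.
- rewrite /ae_on => M M0 gM.
  have g1M : {ae mu, forall t, `|g1 t| <= kappa^-1 * M}.
    apply: (@filterS _ _ (ae_filter_ringOfSetsType mu) _ _ _ gM) => t gt; rewrite /g1 restrict_itvE.
    have [tT|_] := boolP (0 < t < T); last by rewrite normr0 mulr_ge0// invr_ge0 ltW.
    rewrite normrM ger0_norm ?invr_ge0 ?(ltW kappa_gt0)// ler_wpM2l ?invr_ge0 ?(ltW kappa_gt0)//.
    rewrite normrM ger0_norm ?expR_ge0// -[leRHS]mul1r ler_pM ?expR_ge0//.
      by have [] := expc_bounds tT.
    by apply: gt; rewrite in_itv.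
  have kM : 0 <= kappa^-1 * M by rewrite mulr_ge0// invr_ge0 ltW.
  apply: (@filterS _ _ (ae_filter_ringOfSetsType mu) _ _ _ (woo _ kM g1M)) => t wt; rewrite in_itv/= => /expc_bounds[_ ex].
  rewrite /u normrM (_ : _ * M = expR (c * T) * (2 * (kappa^-1 * M))); last by ring.
  by rewrite ler_pM// ger0_norm ?expR_ge0.
Qed.

(** The weighted difference of two solutions is dominated by its image under the
    small kernel. *)
Lemma volterra_unique (v1 v2 : R -> R) : L1 T v1 -> L1 T v2 ->
  ae_on T (fun t => kappa * v1 t + volterra h v1 t = kappa * v2 t + volterra h v2 t) ->
  ae_on T (fun t => v1 t = v2 t).
Proof.
move=> i1 i2 e12.
pose v (t : R) : R := v1 t - v2 t.
pose w : R -> R := (fun t => expR (- c * t) * v t) \_ `]0, T[.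
have iv : L1 T v by exact: (@integrableB _ _ _ mu _ mI _ _ i1 i2).
have iw : mu.-integrable setT (EFin \o w).
  apply: integrable_restrict; apply: (@integrable_weight _ 1) => // x.
  by move=> /expc_bounds[].
have mw : measurable_fun setT w by apply/measurable_EFinP; exact: measurable_int iw.
suff w0 : {ae mu, forall t, w t = 0}.
  apply: (@filterS _ _ (ae_filter_ringOfSetsType mu) _ _ _ w0) => t + tI; rewrite /w restrict_itvE.
  have -> : 0 < t < T by move: tI; rewrite in_itv.
  move=> /eqP; rewrite mulf_eq0 gt_eqF ?expR_gt0//= /v subr_eq0.
  by move=> /eqP.
apply: (@Schur_contraction_eq0 _ _ R mu K mK K1 w iw).
have ae1 := volterra_section_integrable ih i1.
have ae2 := volterra_section_integrable ih i2.
apply: (@filterS3 _ _ (ae_filter_ringOfSetsType mu) _ _ _ _ _ e12 ae1 ae2).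
move=> t et it1 it2; have [tT|tT] := boolP (0 < t < T); last first.
  by rewrite /w restrict_itvE (negbTE tT) normr0 integral_ge0.
have tI : t \in `]0, T[ by rewrite in_itv.
have wv (s : R) : 0 < s < T -> expR (c * s) * w s = v s.
  move=> sT; rewrite /w restrict_itvE sT mulrA -expRD mulNr subrr expR0 mul1r//.
have mt : measurable (`]0, t[ : set R) by exact: measurable_itv.
have itv := @integrableB _ _ _ mu _ mt _ _ (it1 tI) (it2 tI).
have hv : volterra h v1 t - volterra h v2 t = volterra h (fun s => expR (c * s) * w s) t.
  rewrite /volterra -(@RintegralB _ _ _ mu _ _ _ mt (it1 tI) (it2 tI)).
  apply: eq_Rintegral => s; rewrite inE/= in_itv/= => /andP[s0 st].
  rewrite wv; first by rewrite /v mulrBr.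
  by rewrite s0 (lt_trans st)//; have /andP[] := tT.
have itw : mu.-integrable `]0, t[ (EFin \o (fun s => h (t - s) * (expR (c * s) * w s))).
  apply: eq_integrable itv => // s; rewrite inE/= in_itv/= => /andP[s0 st].
  rewrite wv; first by rewrite /v mulrBr.
  by rewrite s0 (lt_trans st)//; have /andP[] := tT.
have wE : w t = - \int[mu]_s (K (t, s) * w s).
  rewrite (Rintegral_K tT itw) -hv /w restrict_itvE tT.
  have E : volterra h v1 t - volterra h v2 t = - (kappa * v t).
    by have := et tI; rewrite /v; lra.
  by rewrite E; field; rewrite gt_eqF.
rewrite wE normrN.
apply: (@le_trans _ _ (`|\int[mu]_s (K (t, s) * w s)%:E|)%E).
  by rewrite /Rintegral; case: (\int[mu]_s _)%E => //= *; rewrite ?normr0 ?leey.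
apply: le_abse_integral => //; apply/measurable_EFinP; apply: measurable_funM => //.
exact: (measurableT_comp mK (measurable_pair1 t)).
Qed.

End Resolvent.

(** * The Abel equation *)

(** Both sides of the Abel equation are primitives, so the equation amounts to
    the equality of the integrands. *)
Lemma abel_eq_volterra {R : realType} (T kappa : R) (a h f f' v : R -> R) :
  L1 T h ->
  (forall x, 0 < x < T ->
    abel_kernel a x = kappa + \int[@lebesgue_measure R]_(s in `]0, x[) h s) ->
  L1 T f' ->
  (forall t, t \in `[0, T] -> f t = \int[@lebesgue_measure R]_(s in `]0, t[) f' s) ->
  L1 T v ->
  abel_eq T a f v <-> ae_on T (fun t => kappa * v t + volterra h v t = f' t).
Proof.
set mu := @lebesgue_measure R => ih kE if' fE iv.
have mI : measurable (`]0, T[ : set R) by exact: measurable_itv.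
have ikv : L1 T (fun t => kappa * v t) := @integrableZl _ _ _ mu _ mI kappa _ iv.
have ik : L1 T (fun t => kappa * v t + volterra h v t).
  exact: (@integrableD _ _ _ mu _ mI _ _ ikv (volterra_integrable ih iv)).
split=> [eqv|eqv t tI].
  apply: (ae_eq_of_primitive ik if') => t tI.
  have tI' : t \in `[0, T] by exact: subset_itv_oo_cc tI.
  have := eqv t tI'; rewrite (abel_conv_volterra ih iv kE tI') fE//.
  by case.
rewrite (abel_conv_volterra ih iv kE tI) fE//; congr EFin.
have tT : t <= T by move: tI; rewrite in_itv/= => /andP[].
rewrite /Rintegral; congr fine; apply: ae_eq_integral => //.
- exact: measurable_int (L1_subitv ik tT).
- exact: measurable_int (L1_subitv if' tT).
apply: (@filterS _ _ (ae_filter_ringOfSetsType mu) _ _ _ eqv) => s es.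
rewrite /= in_itv/= => /andP[s0 st]; rewrite es// in_itv/= s0/=.
exact: lt_le_trans tT.
Qed.

Theorem mainTheorem11 (R : realType) (T L : R) (a a1 a2 a3 : R -> R)
  (T_gt0 : 0 < T) (L_gt0 : 0 < L)
  (a_a1 : deriv_on T a a1) (a1_a2 : deriv_on T a1 a2) (a2_a3 : deriv_on T a2 a3)
  (a_bound : forall t, t \in `[0, T] -> `|a1 t| + `|a2 t| + `|a3 t| <= L)
  (a_01 : forall t, t \in `]0, T] -> 0 < a t < 1)
  (a0 : a 0 = 1) (a1_neq0 : a1 0 != 0) :
  exists2 Q : R, 0 < Q &
    forall f f' : R -> R, W11 T f f' -> f 0 = 0 ->
    exists u : R -> R,
      [/\ L1 T u /\ abel_eq T a f u,
          forall v, L1 T v -> abel_eq T a f v -> ae_on T (fun t => v t = u t),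
          (L1norm T u <= Q%:E * W11norm T f f')%E &
          forall Lf : R, 0 < Lf -> ae_on T (fun t => `|f' t| <= Lf) ->
            ae_on T (fun t => `|u t| <= Q * Lf)].
Proof.
have [kappa [h [k0 ih kE]]] :=
  abel_kernel_regular T_gt0 L_gt0 a_a1 a1_a2 a_bound a_01 a0 a1_neq0.
have k20 : 0 < kappa / 2 by rewrite divr_gt0.
have [c c0 hc] := small_exponential_weight ih k20.
pose Q := 2 * expR (c * T) / kappa.
have Q0 : 0 < Q by rewrite divr_gt0// mulr_gt0// expR_gt0.
exists Q => // f f' Wf f0.
have fE := W11_integral T_gt0 Wf f0.
have [_ if' _ _] := Wf.
have [u [iu eu u1 uoo]] := volterra_resolvent k0 c0 ih hc if'.
have abelE v := abel_eq_volterra (v := v) ih kE if' fE.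
exists u; split.
- by split=> //; apply/abelE.
- move=> v iv /abelE-/(_ iv) ev; apply: (volterra_unique k0 c0 ih hc iv iu).
  apply: (@filterS2 _ _ (ae_filter_ringOfSetsType (@lebesgue_measure R)) _ _ _ _ ev eu).
  by move=> t evt eut tI; rewrite evt// eut.
- apply: (le_trans u1); rewrite lee_wpmul2l ?lee_fin ?(ltW Q0)// /W11norm leeDr//.
  by apply: integral_ge0 => x _; rewrite lee_fin.
- by move=> Lf Lf0 hf; apply: uoo => //; exact: ltW.
Qed.
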